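(* In the real (resp. complex) projective 3-space, let $f,f_{12},f_{13},f_{14},f_{23},f_{24},f_{34}$ be seven points and let $f_1,f_2,f_3,f_4$ be four lines. Assume that the six tiles with vertices labeled in cyclic order by $(f,f_i,f_{ij},f_j)$, $1\le i<j\le4$, are coherent and that the eleven inputs $f,f_i,f_{ij}$ are generic subject to this condition. For each triple $1\le i<j<k\le4$, let $f_{ijk}$ be the unique line such that the three tiles $$(f_i,f_{ij},f_{ijk},f_{ik}),\quad (f_j,f_{ij},f_{ijk},f_{jk}),\quad (f_k,f_{ik},f_{ijk},f_{jk})$$ are coherent. Then there exists a unique point $f_{1234}$ that makes all tiles of the 4-dimensional cube coherent, i.e. such that, in addition to the tiles listed above, the six tiles $(f_{ij},f_{ijk},f_{1234},f_{ij\ell})$, $\{i,j,k,\ell\}=\{1,2,3,4\}$, are coherent.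
   Context: Conventions: $f_{ij}=f_{ji}$, $f_{ijk}=f_{jik}=f_{ikj}=\cdots$. Coherence of a tile in 3-space labeled by points and lines: for distinct points $A,B$ and distinct lines $\ell,m$ in projective 3-space, the tile with vertices labeled cyclically $A,\ell,B,m$ is coherent if neither $A$ nor $B$ is incident to either $\ell$ or $m$, the lines $\ell$ and $m$ intersect at some point $P$, and the line $(AB)$ passes through $P$. The notion does not depend on which of the four vertices is listed first or on the direction of listing. Existence and uniqueness of the line $f_{ijk}$ hold for generic inputs: the lines $f_i,f_j,f_k$ lie in a common plane $h$ and $f_{ijk}=h\cap(f_{ij}f_{ik}f_{jk})$, where $(XYZ)$ is the plane through $X,Y,Z$. The labels $f_I$ are placed at the vertices of the 4-cube indexed by subsets $I\subset\{1,2,3,4\}$; tiles are the 2-dimensional faces. ''Generic'' means belonging to a suitable Zariski dense (concretely, nonempty Zariski open) subset of the space of configurations satisfying the stated conditions.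
   Formalization: Generic means: in a nonempty Zariski open set of inputs with coherent tiles, dense among those whose lines f_1,…,f_4 are coplanar. Density is not required where the four lines are concurrent but not coplanar, since there the line f_{ijk} is never unique. *)

(* Defs.v *)
From HB Require Import structures.
From mathcomp Require Import all_boot all_order all_algebra.
From mathcomp Require Import mpoly.
From mathcomp Require Import complex.
From mathcomp Require Import reals.

Set Implicit Arguments.
Unset Strict Implicit.
Unset Printing Implicit Defensive.

Import GRing.Theory.
Local Open Scope ring_scope.

(** Projective 3-space over [K] is the set of subspaces of [K^4]: points, lines
    and planes are the subspaces of dimension 1, 2 and 3, and incidence is
    inclusion. *)

Definition subspace (K : fieldType) (d : nat) : Type :=
  {V : {vspace 'rV[K]_4} | \dim V == d}.

Notation point K := (subspace K 1).
Notation line K := (subspace K 2).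
Notation plane K := (subspace K 3).

Definition space_of (K : fieldType) (d : nat) (V : subspace K d) :
  {vspace 'rV[K]_4} := sval V.
Coercion space_of : subspace >-> space.

(** The tile with vertices [A, l, B, m] in cyclic order. When [A] and [B] are
    distinct, [(A + B)%VS] is the line [(AB)]. *)
Definition coherent (K : fieldType) (A : point K) (l : line K)
    (B : point K) (m : line K) : Prop :=
  [/\ A <> B,
      l <> m,
      [/\ ~~ (A <= l)%VS, ~~ (A <= m)%VS, ~~ (B <= l)%VS & ~~ (B <= m)%VS]
    & exists P : point K, [/\ (P <= l)%VS, (P <= m)%VS & (P <= A + B)%VS]].

Record config (K : fieldType) : Type := Config {
  f_ : point K;
  f1 : line K; f2 : line K; f3 : line K; f4 : line K;
  f12 : point K; f13 : point K; f14 : point K;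
  f23 : point K; f24 : point K; f34 : point K }.

Definition admissible (K : fieldType) (c : config K) : Prop :=
  [/\ coherent (f_ c) (f1 c) (f12 c) (f2 c),
      coherent (f_ c) (f1 c) (f13 c) (f3 c)
    & coherent (f_ c) (f1 c) (f14 c) (f4 c)] /\
  [/\ coherent (f_ c) (f2 c) (f23 c) (f3 c),
      coherent (f_ c) (f2 c) (f24 c) (f4 c)
    & coherent (f_ c) (f3 c) (f34 c) (f4 c)].

(** The line [fijk] completes the 3-cube at [fi, fj, fk, fij, fik, fjk]. The
    tile [(fi, fij, fijk, fik)] is listed from the point [fij], as
    [(fij, fijk, fik, fi)]; likewise for the other two. *)
Definition completes3 (K : fieldType) (fi fj fk : line K)
    (fij fik fjk : point K) (fijk : line K) : Prop :=
  [/\ coherent fij fijk fik fi,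
      coherent fij fijk fjk fj
    & coherent fik fijk fjk fk].

Definition completes4 (K : fieldType) (c : config K)
    (f123 f124 f134 f234 : line K) (f1234 : point K) : Prop :=
  [/\ coherent (f12 c) f123 f1234 f124,
      coherent (f13 c) f123 f1234 f134
    & coherent (f14 c) f124 f1234 f134] /\
  [/\ coherent (f23 c) f123 f1234 f234,
      coherent (f24 c) f124 f1234 f234
    & coherent (f34 c) f134 f1234 f234].

(** * Zariski topology on the space of all configurations *)

Definition config_points (K : fieldType) (c : config K) : 7.-tuple (point K) :=
  [tuple f_ c; f12 c; f13 c; f14 c; f23 c; f24 c; f34 c].

Definition config_lines (K : fieldType) (c : config K) : 4.-tuple (line K) :=
  [tuple f1 c; f2 c; f3 c; f4 c].

(** The (a, b) entry is the Plücker coordinate [u_a v_b - u_b v_a] of the line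
    spanned by [u] and [v]. All sixteen entries are kept; the matrix is
    alternating, so this is the usual 6-tuple with repetitions up to sign. *)
Definition plucker (K : fieldType) (u v : 'rV[K]_4) : 'M[K]_4 :=
  u^T *m v - v^T *m u.

(** [P] and [L] list homogeneous coordinates of the seven points and Plücker
    coordinates of the four lines of [c]; each of the eleven vectors is
    determined by [c] up to a nonzero scalar. The generators are automatically
    nonzero, resp. independent, by the dimension of the space they span. *)
Definition hom_coords (K : fieldType) (c : config K)
    (P : 'I_7 -> 'rV[K]_4) (L : 'I_4 -> 'M[K]_4) : Prop :=
  (forall i, space_of (tnth (config_points c) i) = <[P i]>%VS) /\
  (forall j, exists u v : 'rV[K]_4,
     space_of (tnth (config_lines c) j) = (<[u]> + <[v]>)%VS /\
     L j = plucker u v).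

Definition coord_index : finType :=
  ('I_7 * 'I_4 + 'I_4 * ('I_4 * 'I_4))%type.

Definition coord_val (K : fieldType) (P : 'I_7 -> 'rV[K]_4)
    (L : 'I_4 -> 'M[K]_4) (x : coord_index) : K :=
  match x with
  | inl (i, a) => P i 0 a
  | inr (j, (a, b)) => L j a b
  end.

(** [p] vanishes at [c] if it does so for every choice of homogeneous
    coordinates. Since [K] will be infinite, this amounts to the vanishing of
    all multihomogeneous components of [p] at [c], so the closed sets below are
    the zero loci of multihomogeneous polynomials. *)
Definition vanishes_at (K : fieldType) (p : {mpoly K[#|coord_index|]})
    (c : config K) : Prop :=
  forall P L, hom_coords c P L ->
    p.@[fun k => coord_val P L (enum_val k)] = 0.

Definition zariski_closed (K : fieldType) (Z : config K -> Prop) : Prop :=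
  exists S : {mpoly K[#|coord_index|]} -> Prop,
    forall c, Z c <-> (forall p, S p -> vanishes_at p c).

Definition zariski_open (K : fieldType) (U : config K -> Prop) : Prop :=
  zariski_closed (fun c => ~ U c).

Definition zariski_dense_in (K : fieldType) (U X : config K -> Prop) : Prop :=
  forall V : config K -> Prop, zariski_open V ->
    (exists c, X c /\ V c) -> exists c, [/\ X c, V c & U c].

Definition coplanar (K : fieldType) (c : config K) : Prop :=
  exists h : plane K, [/\ (f1 c <= h)%VS, (f2 c <= h)%VS,
                          (f3 c <= h)%VS & (f4 c <= h)%VS].

(** [Q] holds on a nonempty Zariski open part [U] of the space of admissible
    configurations. In an admissible configuration the lines [f1, ..., f4] are
    distinct and meet pairwise, so they are coplanar or concurrent; this gives
    two irreducible components of the same dimension. When the four lines are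
    concurrent and not coplanar, the lines [fijk] are never unique. Generic
    configurations are therefore those of the coplanar component, in which [U]
    is required to be dense. *)
Definition generically (K : fieldType) (Q : config K -> Prop) : Prop :=
  exists U : config K -> Prop,
    [/\ zariski_open U,
        (exists c, admissible c /\ U c),
        zariski_dense_in U (fun c => admissible c /\ coplanar c)
      & forall c, admissible c -> U c -> Q c].

(* Main.v *)
Require Import Defs.
From HB Require Import structures.
From mathcomp Require Import all_boot all_order all_algebra.
From mathcomp Require Import mpoly.
From mathcomp Require Import complex.
From mathcomp Require Import reals boolp.
From mathcomp Require Import ring.

Set Implicit Arguments.
Unset Strict Implicit.
Unset Printing Implicit Defensive.

Import GRing.Theory Num.Theory.
Local Open Scope ring_scope.

(** Why the theorem holds.

    Suppose that the four lines lie in a plane [h] and that the vector [F]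
    spanning [f] is not in [h]. Coherence of [(f, fi, fij, fj)] says that the
    line [(f fij)] passes through the point where [fi] and [fj] meet, so [fij]
    is spanned by [F + p] for some [p] on both lines ([tile_center]). Call this
    vector [pij]. In the affine chart [p |-> <F + p>] of the complement of [h],
    a tile made of the points [<F + p>], [<F + q>] and of two distinct lines
    of [h] is coherent exactly when [p <> q] and [q - p] lies on both lines
    ([tile_intro], [tile_elim]). Everything else is linear algebra in [h].

    The three tiles around [fijk] say that this line contains [pik - pij] and
    [pjk - pij], which determine it when [pij], [pik], [pjk] are independent
    ([completes3P]): it is the trace on [h] of the plane [(fij fik fjk)]. If
    [f1234] is spanned by [F + X], the tile at [fij] asks that [X - pij] be on
    both lines [fijk] and [fijl], that is, that [f1234] be on both planes. So
    the four planes [(fij fik fjk)] must have a common point, and this is Cox's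
    theorem for four planes through [f] ([cox]); uniqueness follows from two of
    the six tiles ([cube4_completion]).

    Genericity is one polynomial inequation ([genericity]). The
    non-coplanarity of [f, fij, fik, fjk] for each triple yields the plane [h],
    puts [f] off it and makes no three lines concurrent; the non-coplanarity of
    some quadruples of the [fij] keeps the lines [fijk] distinct and [f1234]
    away from the [fij]; a last factor says that the point common to three of
    the four planes is off [h], hence of the form [<F + X>].

    For density it is enough that the coplanar admissible configurations form
    an irreducible set ([coplanar_irreducible]) containing one configuration
    with non-vanishing [genericity] ([genericity_example]). They are
    parametrized, homogeneous coordinates included, by the complement of
    a hypersurface in an affine space ([config_param], [param_config]). Along the
    affine line joining two parameters, polynomial conditions on the
    configuration become polynomials in one variable, and finitely many nonzero
    ones have a common non-root. *)

(** * Determinants and subspaces of a 4-dimensional space *)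

Definition i0 : 'I_4 := @Ordinal 4 0 isT.
Definition i1 : 'I_4 := @Ordinal 4 1 isT.
Definition i2 : 'I_4 := @Ordinal 4 2 isT.
Definition i3 : 'I_4 := @Ordinal 4 3 isT.

Lemma ord4P (Q : 'I_4 -> Prop) : Q i0 -> Q i1 -> Q i2 -> Q i3 -> forall i, Q i.
Proof.
move=> h0 h1 h2 h3 [[|[|[|[|//]]]] lti].
- by rewrite (_ : Ordinal lti = i0) //; apply: val_inj.
- by rewrite (_ : Ordinal lti = i1) //; apply: val_inj.
- by rewrite (_ : Ordinal lti = i2) //; apply: val_inj.
- by rewrite (_ : Ordinal lti = i3) //; apply: val_inj.
Qed.

Lemma sum_ord4 (V : nmodType) (E : 'I_4 -> V) :
  \sum_(i < 4) E i = E i0 + (E i1 + (E i2 + E i3)).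
Proof.
rewrite !big_ord_recl big_ord0 addr0.
by congr (E _ + (E _ + (E _ + E _))); apply: val_inj.
Qed.

(** The pairing of a bivector [L] with [w] and [x] induced by the exterior
    product: it gives determinants of which two rows are known only through
    their Plücker coordinates. *)
Definition plucker_pairing (K : fieldType) (L : 'M[K]_4) (w x : 'rV[K]_4) : K :=
  L i0 i1 * (w 0 i2 * x 0 i3 - w 0 i3 * x 0 i2)
  - L i0 i2 * (w 0 i1 * x 0 i3 - w 0 i3 * x 0 i1)
  + L i0 i3 * (w 0 i1 * x 0 i2 - w 0 i2 * x 0 i1)
  + L i1 i2 * (w 0 i0 * x 0 i3 - w 0 i3 * x 0 i0)
  - L i1 i3 * (w 0 i0 * x 0 i2 - w 0 i2 * x 0 i0)
  + L i2 i3 * (w 0 i0 * x 0 i1 - w 0 i1 * x 0 i0).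

(** The Laplace expansion along the first two rows. Having an explicit
    polynomial rather than [\det] makes every multilinear identity below a ring
    identity in the coordinates. *)
Definition det4 (K : fieldType) (x y z w : 'rV[K]_4) : K :=
  plucker_pairing (plucker x y) z w.

Lemma pluckerE (K : fieldType) (x y : 'rV[K]_4) i j :
  plucker x y i j = x 0 i * y 0 j - y 0 i * x 0 j.
Proof. by rewrite !mxE !big_ord1 !mxE. Qed.

Ltac vec_ring := apply/rowP=> ?; rewrite !mxE; ring.
Ltac det4_ring := rewrite /det4 /plucker_pairing ?pluckerE ?mxE; ring.

Section Det4.
Variable K : fieldType.
Implicit Types (x y z w v : 'rV[K]_4).

Definition rows4 x y z w : 'M[K]_4 :=
  \matrix_(i, j) (tnth [tuple x; y; z; w] i) 0 j.

Definition nat_mx n (e : nat -> nat -> K) : 'M[K]_n := \matrix_(i, j) e i j.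

Lemma det_nat_mx n (e : nat -> nat -> K) :
  \det (nat_mx n.+1 e) =
  \sum_(j < n.+1) (-1) ^+ j * e 0%N j *
    \det (nat_mx n (fun i k => e i.+1 (bump j k))).
Proof.
rewrite (expand_det_row _ ord0); apply: eq_bigr => j _.
rewrite /cofactor mxE mulrA [e _ _ * _]mulrC; congr (_ * _ * \det _).
by apply/matrixP=> i k; rewrite !mxE.
Qed.

Lemma det_nat_mx3 (e : nat -> nat -> K) :
  \det (nat_mx 3 e) =
  e 0%N 0%N * (e 1%N 1%N * e 2%N 2%N - e 1%N 2%N * e 2%N 1%N)
  - e 0%N 1%N * (e 1%N 0%N * e 2%N 2%N - e 1%N 2%N * e 2%N 0%N)
  + e 0%N 2%N * (e 1%N 0%N * e 2%N 1%N - e 1%N 1%N * e 2%N 0%N).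
Proof.
do 3!rewrite !det_nat_mx ?big_ord_recl ?big_ord0.
rewrite !det_mx00 /= /bump /=.
ring.
Qed.

Lemma det4E x y z w : det4 x y z w = \det (rows4 x y z w).
Proof.
pose e (i j : nat) : K :=
  nth 0 [:: x; y; z; w] i 0 (nth i0 [:: i0; i1; i2; i3] j).
have -> : rows4 x y z w = nat_mx 4 e.
  by apply/matrixP; apply: ord4P; apply: ord4P; rewrite !mxE.
rewrite /det4 /plucker_pairing !pluckerE det_nat_mx !big_ord_recl big_ord0.
rewrite !det_nat_mx3 /= /bump /= /e /=.
ring.
Qed.

Lemma det4_mulmx x y z w (G : 'M[K]_4) :
  det4 (x *m G) (y *m G) (z *m G) (w *m G) = det4 x y z w * \det G.
Proof.
rewrite !det4E -det_mulmx; congr (\det _).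
apply/matrixP; apply: ord4P => j; rewrite !mxE;
  by apply: eq_bigr => k _; rewrite !mxE.
Qed.

Lemma det4_comb x y z a v b w :
  det4 x y z (a *: v + b *: w) = a * det4 x y z v + b * det4 x y z w.
Proof. det4_ring. Qed.

Lemma det4_repeat x y z : [/\ det4 x y z x = 0, det4 x y z y = 0 & det4 x y z z = 0].
Proof. by split; det4_ring. Qed.

Lemma cramer4 x y z w v :
  det4 x y z w *: v = det4 v y z w *: x + det4 x v z w *: y
                    + det4 x y v w *: z + det4 x y z v *: w.
Proof. by apply/rowP; apply: ord4P; rewrite !mxE; det4_ring. Qed.

Lemma det4_indep x y z w a b c d : det4 x y z w != 0 ->
  a *: x + b *: y + c *: z + d *: w = 0 -> [/\ a = 0, b = 0, c = 0 & d = 0].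
Proof.
move=> nz rel.
have F (f : 'rV[K]_4 -> K) k : f 0 = 0 ->
    f (a *: x + b *: y + c *: z + d *: w) = k * det4 x y z w -> k = 0.
  by move=> f0; rewrite rel f0 => /esym/eqP; rewrite mulf_eq0 (negPf nz) orbF => /eqP.
by split; [apply: (F (fun v => det4 v y z w))| apply: (F (fun v => det4 x v z w))
  | apply: (F (fun v => det4 x y v w))| apply: (F (fun v => det4 x y z v))]; det4_ring.
Qed.

Lemma det4_eq0 x y z w : det4 x y z w = 0 ->
  exists a b c d, a *: x + b *: y + c *: z + d *: w = 0 /\
    ~ [/\ a = 0, b = 0, c = 0 & d = 0].
Proof.
rewrite det4E => /eqP/det0P[v nzv rel].
exists (v 0 i0), (v 0 i1), (v 0 i2), (v 0 i3); split.
  rewrite -rel mulmx_sum_row sum_ord4 !addrA.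
  by congr (_ *: _ + _ *: _ + _ *: _ + _ *: _); apply/rowP=> j; rewrite !mxE.
case=> e0 e1 e2 e3; case/negP: nzv; apply/eqP/rowP.
by apply: ord4P; rewrite mxE.
Qed.

Definition row4 (a b c d : K) : 'rV[K]_4 := \row_j nth 0 [:: a; b; c; d] j.

Lemma row4_mulmx a b c d x y z w :
  row4 a b c d *m rows4 x y z w = a *: x + b *: y + c *: z + d *: w.
Proof.
rewrite mulmx_sum_row sum_ord4 !addrA.
by congr (_ *: _ + _ *: _ + _ *: _ + _ *: _); rewrite ?mxE //;
  apply/rowP=> j; rewrite !mxE.
Qed.

Local Notation vec := 'rV[K]_4.

Lemma mem_span2P (u v x : vec) :
  reflect (exists a b, x = a *: u + b *: v) (x \in <[u]> + <[v]>)%VS.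
Proof.
apply: (iffP memv_addP) => [[_ /vlineP[a ->] [_ /vlineP[b ->] ->]]|[a [b ->]]].
  by exists a, b.
by exists (a *: u); [|exists (b *: v)]; rewrite ?memvZ ?memv_line.
Qed.

Lemma mem_span2l (u v : vec) : u \in (<[u]> + <[v]>)%VS.
Proof. by apply/mem_span2P; exists 1, 0; rewrite scale1r scale0r addr0. Qed.

Lemma mem_span2r (u v : vec) : v \in (<[u]> + <[v]>)%VS.
Proof. by rewrite addvC mem_span2l. Qed.

Definition indep2 (u v : vec) :=
  forall a b, a *: u + b *: v = 0 -> a = 0 /\ b = 0.

Lemma dim2P (u v : vec) : \dim (<[u]> + <[v]>) = 2 <-> indep2 u v.
Proof.
split=> [dim2 a b rel|ind].
  have small (x : vec) : (<[u]> + <[v]> <= <[x]>)%VS -> False.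
    by move/dimvS; rewrite dim2 dim_vline; case: (x != 0).
  split; apply/eqP/negP => /negP nz.
    apply: (small v); rewrite subv_add subvv andbT -memvE; apply/vlineP.
    exists (- (b / a)); apply: (scalerI nz).
    rewrite scalerA mulrN mulrCA divff // mulr1 scaleNr.
    by apply/eqP; rewrite -addr_eq0 rel.
  apply: (small u); rewrite subv_add subvv /= -memvE; apply/vlineP.
  exists (- (a / b)); apply: (scalerI nz).
  rewrite scalerA mulrN mulrCA divff // mulr1 scaleNr.
  by apply/eqP; rewrite -addr_eq0 addrC rel.
rewrite dimv_disjoint_sum; last first.
  apply/eqP; rewrite -subv0; apply/subvP=> x /[!memv_cap]/andP[/vlineP[a xa] /vlineP[b xb]].
  have [|a0 _] := ind a (- b); first by rewrite -xa scaleNr -xb subrr.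
  by rewrite xa a0 scale0r mem0v.
rewrite !dim_vline.
have -> : u != 0.
  by apply/eqP=> u0; have [|/eqP] := ind 1 0; rewrite ?u0 ?scaler0 ?scale0r ?addr0 ?oner_eq0.
have -> // : v != 0.
by apply/eqP=> v0; have [|_ /eqP] := ind 0 1; rewrite ?v0 ?scaler0 ?scale0r ?addr0 ?oner_eq0.
Qed.

(** A triple of independent vectors is completed to a basis. The added vector
    serves as a witness: the independence of [f], [u], [v] becomes the
    non-vanishing of a polynomial in them. *)
Lemma det4_extend (f u v : vec) : f \notin (<[u]> + <[v]>)%VS -> indep2 u v ->
  exists w, det4 f u v w != 0.
Proof.
move=> nf ind; set S := (<[f]> + (<[u]> + <[v]>))%VS.
have /subvPn[w _ nw] : ~~ (fullv <= S)%VS.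
  apply/negP=> /dimvS; rewrite dimvf /dim /= mul1n leqNgt ltnS => /negP; apply.
  apply: leq_trans (dimv_add_leqif _ _) _.
  by move/dim2P: ind => ->; rewrite dim_vline; case: (f != 0).
exists w; apply/eqP=> /det4_eq0[a [b [c [d [rel nz]]]]].
have memS (x y z : K) : x *: f + y *: u + z *: v \in S.
  by rewrite -addrA memv_add ?memvZ ?memv_line // memv_add ?memvZ ?memv_line.
have d0 : d = 0.
  apply/eqP/negP=> /negP nzd; case/negP: nw.
  have -> : w = - d^-1 *: (a *: f + b *: u + c *: v).
    have -> : a *: f + b *: u + c *: v = - (d *: w) by apply/eqP; rewrite -addr_eq0 rel.
    by rewrite scalerN scaleNr opprK scalerA mulVf // scale1r.
  by rewrite memvZ.
move: rel; rewrite d0 scale0r addr0 => rel.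
have a0 : a = 0.
  apply/eqP/negP=> /negP nza; case/negP: nf; apply/mem_span2P.
  exists (- (a^-1 * b)), (- (a^-1 * c)).
  apply: (scalerI nza); rewrite scalerDr !scalerA !mulrN !mulrA divff // !mul1r.
  by apply/eqP; rewrite !scaleNr -opprD -addr_eq0 addrA rel.
move: rel; rewrite a0 scale0r add0r => /ind[b0 c0].
exact: nz.
Qed.

Lemma in_span3 (x y z w v : vec) : det4 x y z w != 0 -> det4 x y z v = 0 ->
  exists a b c, v = a *: x + b *: y + c *: z.
Proof.
move=> nz v0; set d := det4 x y z w in nz.
exists (d^-1 * det4 v y z w), (d^-1 * det4 x v z w), (d^-1 * det4 x y v w).
apply: (scalerI nz); rewrite cramer4 v0 scale0r addr0.
by rewrite !scalerDr !scalerA !mulrA divff // !mul1r.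
Qed.
End Det4.

(** * Tiles in the affine chart of a plane *)

Section Geometry.
Variable K : fieldType.
Local Notation vec := 'rV[K]_4.
Implicit Types (x y z p q r s X F : vec) (h : {vspace vec}).

Lemma subspace_eq d (A B : subspace K d) : space_of A = space_of B -> A = B.
Proof. exact: val_inj. Qed.

Lemma subspace_ex d (V : {vspace vec}) : \dim V = d ->
  exists A : subspace K d, space_of A = V.
Proof. by move/eqP=> dimV; exists (exist _ V dimV). Qed.

Lemma point_ex x : x != 0 -> exists A : point K, space_of A = <[x]>%VS.
Proof. by move=> nzx; apply: subspace_ex; rewrite dim_vline nzx. Qed.

Lemma line_ex x y : indep2 x y ->
  exists l : line K, space_of l = (<[x]> + <[y]>)%VS.
Proof. by move/dim2P; apply: subspace_ex. Qed.


Lemma mem_dim_lt (U V : {vspace vec}) : (\dim V < \dim U)%N ->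
  exists2 x, x \in U & x \notin V.
Proof.
move=> ltVU; apply/subvPn; apply/negP=> /dimvS.
by rewrite leqNgt ltVU.
Qed.

Lemma dim_subspace d (A : subspace K d) : \dim A = d.
Proof. exact/eqP/(svalP A). Qed.

Lemma pointE (A : point K) : exists2 x, x != 0 & space_of A = <[x]>%VS.
Proof.
have [|x xA x0] := @mem_dim_lt A 0%VS; first by rewrite dimv0 dim_subspace.
have nzx : x != 0 by rewrite memv0 in x0.
exists x => //; apply/eqP; rewrite eq_sym eqEdim -memvE xA.
by rewrite dim_subspace dim_vline nzx.
Qed.

Lemma indep2_notin x y : x != 0 -> y \notin <[x]>%VS -> indep2 x y.
Proof.
move=> nzx /negP yx a b rel.
have b0 : b = 0.
  apply/eqP/negP=> /negP nzb; apply: yx; apply/vlineP; exists (- (b^-1 * a)).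
  apply: (scalerI nzb); rewrite scalerA mulrN mulrA divff // mul1r scaleNr.
  by apply/eqP; rewrite -addr_eq0 addrC rel.
split=> //; move/eqP: rel; rewrite b0 scale0r addr0 scaler_eq0 (negPf nzx) orbF.
by move/eqP.
Qed.

Lemma lineE_in (l : line K) x y : x \in space_of l -> y \in space_of l ->
  indep2 x y -> space_of l = (<[x]> + <[y]>)%VS.
Proof.
move=> xl yl /dim2P dim2; apply/eqP; rewrite eq_sym eqEdim dim2 dim_subspace.
by rewrite subv_add -!memvE xl yl.
Qed.

Lemma meet_uniq (l m : line K) x y : l <> m -> x != 0 ->
  x \in space_of l -> x \in space_of m -> y \in space_of l -> y \in space_of m ->
  exists k, y = k *: x.
Proof.
move=> nlm nzx xl xm yl ym; apply/vlineP; apply/negP=> /negP yx.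
have ind := indep2_notin nzx yx.
by apply: nlm; apply: subspace_eq; rewrite (lineE_in xl yl ind) (lineE_in xm ym ind).
Qed.

(** With [F] off [h], the decomposition of a vector into a multiple of [F] and
    an element of [h] is unique; this is how equations between points of the
    chart are turned into equations in [h]. *)
Lemma chart_coef h F a p : F \notin h -> p \in h -> a *: F + p \in h -> a = 0.
Proof.
move=> nF ph; rewrite rpredDr // => aF; apply/eqP/negP=> /negP nza; case/negP: nF.
by rewrite -[F](scalerK nza) memvZ.
Qed.

Lemma chart_neq0 h F p : F \notin h -> p \in h -> F + p != 0.
Proof.
move=> nF ph; apply: contraNneq nF => /eqP; rewrite addr_eq0 => /eqP->.
by rewrite memvN.
Qed.

Lemma chart_notin h F p (l : line K) : F \notin h -> p \in h -> (l <= h)%VS ->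
  F + p \notin space_of l.
Proof.
move=> nF ph lh; apply: contra nF => /(subvP lh) /(rpredB)/(_ ph).
by rewrite addrK.
Qed.

(** The chord [q - p] spans the point at which the line through [<F + p>] and
    [<F + q>] meets [h]; the tile is coherent because both lines pass through
    that point. *)
Lemma tile_intro h F (A B : point K) (l m : line K) p q :
  F \notin h -> p \in h -> q \in h -> (l <= h)%VS -> (m <= h)%VS ->
  space_of A = <[F + p]>%VS -> space_of B = <[F + q]>%VS ->
  l <> m -> p <> q -> q - p \in space_of l -> q - p \in space_of m ->
  coherent A l B m.
Proof.
move=> nF ph qh lh mh EA EB nlm npq ql qm; split=> //.
- move=> AB; have: F + q \in <[F + p]>%VS by rewrite -EA AB EB memv_line.
  case/vlineP=> k e.
  have rel : (1 - k) *: F + (q - k *: p) = 0.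
    have -> : q = k *: (F + p) - F by rewrite -e addrC addKr.
    by vec_ring.
  have /eqP : 1 - k = 0.
    by apply: (@chart_coef h F _ (q - k *: p)); rewrite ?rel ?mem0v ?rpredB ?memvZ.
  rewrite subr_eq0 => /eqP k1; case: npq; apply: (addrI F).
  by rewrite e -k1 scale1r.
- by rewrite EA EB -!memvE; split; apply: (chart_notin nF).
- have [|P EP] := @point_ex (q - p).
    by rewrite subr_eq0; apply/eqP=> /esym.
  exists P; rewrite EP -!memvE; split=> //; rewrite EA EB; apply/mem_span2P.
  by exists (-1), 1; vec_ring.
Qed.

(** Conversely the point required by coherence lies on [m], hence in [h], and
    the line through [<F + p>] and [<F + q>] has only one point there. *)
Lemma tile_elim h F (A B : point K) (l m : line K) p q :
  F \notin h -> p \in h -> q \in h -> (m <= h)%VS ->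
  space_of A = <[F + p]>%VS -> space_of B = <[F + q]>%VS ->
  coherent A l B m -> q - p \in space_of l /\ q - p \in space_of m.
Proof.
move=> nF ph qh mh EA EB [_ _ _ [P [Pl Pm]]].
have [r nzr EP] := pointE P.
move: Pl Pm; rewrite EA EB EP -!memvE => rl rm /mem_span2P[x [y Er]].
have Er2 : r = (x + y) *: F + (x *: p + y *: q).
  by rewrite Er !scalerDr scalerDl addrACA.
have xy0 : x + y = 0.
  apply: (@chart_coef h F _ (x *: p + y *: q)) => //; first by rewrite rpredD ?memvZ.
  by rewrite -Er2 (subvP mh).
have xE : x = - y by apply/eqP; rewrite -addr_eq0 xy0.
have Er3 : r = y *: (q - p) by rewrite Er2 xy0 scale0r add0r xE scaleNr scalerBr addrC.
have nzy : y != 0 by apply: contraNneq nzr => y0; rewrite Er3 y0 scale0r.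
by rewrite -[q - p](scalerK nzy) -Er3 !memvZ.
Qed.

Lemma chord_notin F p q r s :
  det4 (F + p) (F + q) (F + r) (F + s) != 0 -> s - p \notin (<[q - p]> + <[r - p]>)%VS.
Proof.
move=> nz; apply/negP=> /mem_span2P[a [b e]].
have [//|_ _ _ /eqP] := @det4_indep K _ _ _ _ (a + b - 1) (- a) (- b) 1 nz;
  last by rewrite oner_eq0.
have -> : s = p + (a *: (q - p) + b *: (r - p)) by rewrite -e addrC subrK.
by vec_ring.
Qed.

(** A point of the chart lies in the plane through three others exactly when
    the chord joining it to one of them lies on the trace of that plane on [h].
    This lemma and [chord_notin] translate between the two descriptions. *)
Lemma chord_in h F p q r s :
  F \notin h -> p \in h -> q \in h -> r \in h -> s \in h -> det4 F p q r != 0 ->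
  det4 (F + p) (F + q) (F + r) (F + s) = 0 -> s - p \in (<[q - p]> + <[r - p]>)%VS.
Proof.
move=> nF ph qh rh sh nz.
have nz' : det4 (F + p) (F + q) (F + r) F != 0.
  suff -> : det4 (F + p) (F + q) (F + r) F = - det4 F p q r by rewrite oppr_eq0.
  by det4_ring.
move/(in_span3 nz') => [a [b [c e]]].
have sE : s = a *: (F + p) + b *: (F + q) + c *: (F + r) - F by rewrite -e addrC addKr.
have abc : 1 - a - b - c = 0.
  apply: (@chart_coef h F _ (s - a *: p - b *: q - c *: r)) => //.
    by rewrite !rpredB ?memvZ.
  suff -> : (1 - a - b - c) *: F + (s - a *: p - b *: q - c *: r) = 0 by rewrite mem0v.
  by rewrite sE; apply/rowP=> j; rewrite !mxE; ring.
apply/mem_span2P; exists b, c; rewrite sE.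
have -> : a = 1 - b - c by apply/eqP; rewrite -subr_eq0 -oppr_eq0 -abc; apply/eqP; ring.
by vec_ring.
Qed.

End Geometry.

(** * Completing a 3-cube *)

Section Cubes.
Variable K : fieldType.
Local Notation vec := 'rV[K]_4.
Implicit Types (p q r s X F : vec) (h : {vspace vec}).

Lemma det4_indep3 F p q r a b c : det4 F p q r != 0 ->
  a *: p + b *: q + c *: r = 0 -> [/\ a = 0, b = 0 & c = 0].
Proof.
move=> nz rel; have [] := @det4_indep K _ _ _ _ 0 a b c nz; last by [].
by rewrite scale0r add0r.
Qed.

Lemma det4_indep2 F p q r : det4 F p q r != 0 -> indep2 p q.
Proof.
move=> nz a b rel; have [|] := @det4_indep3 F p q r a b 0 nz; last by [].
by rewrite scale0r addr0.
Qed.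

Lemma det4_rotr F p q r : det4 F p q r != 0 -> det4 F q r p != 0.
Proof. by rewrite (_ : det4 F q r p = det4 F p q r) //; det4_ring. Qed.

Lemma det4_transp F p q r : det4 F p q r != 0 -> det4 F q p r != 0.
Proof. by rewrite -oppr_eq0 (_ : - det4 F p q r = det4 F q p r) //; det4_ring. Qed.

(** The tiles at [fi] and [fj] put two independent chords on [l]; the chord
    [r - q] of the tile at [fk] is their difference. *)
Lemma completes3P h F (fi fj fk l : line K) (fij fik fjk : point K) p q r :
  F \notin h -> p \in h -> q \in h -> r \in h -> det4 F p q r != 0 ->
  space_of fi = (<[p]> + <[q]>)%VS -> space_of fj = (<[p]> + <[r]>)%VS ->
  space_of fk = (<[q]> + <[r]>)%VS ->
  space_of fij = <[F + p]>%VS -> space_of fik = <[F + q]>%VS ->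
  space_of fjk = <[F + r]>%VS ->
  completes3 fi fj fk fij fik fjk l <-> space_of l = (<[q - p]> + <[r - p]>)%VS.
Proof.
move=> nF ph qh rh nz Ei Ej Ek Eij Eik Ejk.
have sub x y : x \in h -> y \in h -> (<[x]> + <[y]> <= h)%VS.
  by move=> xh yh; rewrite subv_add -!memvE xh.
have ih : (fi <= h)%VS by rewrite Ei sub.
have jh : (fj <= h)%VS by rewrite Ej sub.
have kh : (fk <= h)%VS by rewrite Ek sub.
split=> [[ti tj _]|El].
  have [ql _] := tile_elim nF ph qh ih Eij Eik ti.
  have [rl _] := tile_elim nF ph rh jh Eij Ejk tj.
  apply: lineE_in => // a b rel.
  have [|_ -> ->//] := @det4_indep3 F p q r (- a - b) a b nz.
  by rewrite -[RHS]rel; vec_ring.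
have lh : (l <= h)%VS by rewrite El sub ?rpredB.
have ql : q - p \in space_of l by rewrite El mem_span2l.
have rl : r - p \in space_of l by rewrite El mem_span2r.
have ne x y z : det4 F x y z != 0 -> x <> y.
  move=> nz' xy; have [|/eqP] := @det4_indep3 F x y z 1 (-1) 0 nz'.
    by rewrite xy; vec_ring.
  by rewrite oner_eq0.
have out (m : line K) x y z a b : det4 F x y z != 0 -> space_of m = (<[x]> + <[y]>)%VS ->
    (a *: x + b *: y) + z \in space_of l -> l <> m.
  move=> nz' Em zl lm; move: zl; rewrite lm Em => /mem_span2P[a' [b' e]].
  have [|] := @det4_indep3 F x y z (a - a') (b - b') 1 nz'.
    have -> : z = a' *: x + b' *: y - (a *: x + b *: y) by rewrite -e addrC addKr.
    by vec_ring.
  by move=> _ _ /eqP; rewrite oner_eq0.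
split.
- apply: (tile_intro nF ph qh) => //.
  + apply: (out fi p q r (-1) 0 nz Ei).
    by rewrite (_ : _ + r = r - p) //; vec_ring.
  + exact: ne nz.
  + by rewrite Ei rpredB ?mem_span2l ?mem_span2r.
- apply: (tile_intro nF ph rh) => //.
  + apply: (out fj p r q (-1) 0 _ Ej).
      by apply: det4_rotr; apply: det4_transp.
    by rewrite (_ : _ + q = q - p) //; vec_ring.
  + by apply: (ne _ _ q); apply: det4_rotr; apply: det4_transp.
  + by rewrite Ej rpredB ?mem_span2l ?mem_span2r.
- have rql : r - q \in space_of l.
    have -> : r - q = (r - p) - (q - p) by vec_ring.
    exact: rpredB.
  apply: (tile_intro nF qh rh) => //.
  + apply: (out fk q r p (-1) 0 _ Ek); first exact: det4_rotr.
    have -> : -1 *: q + 0 *: r + p = - (q - p) by vec_ring.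
    by rewrite memvN.
  + by apply: (ne _ _ p); apply: det4_rotr.
  + by rewrite Ek rpredB ?mem_span2l ?mem_span2r.
Qed.

(** * Cox's theorem *)

(** Cox's theorem, for the four planes through [F] that contain the lines
    [f1, ..., f4]: the four planes through the triples [fij], [fik], [fjk] have
    a common point.

    In the basis [p23, p13, p12] of [h] write [phi123 = 1], [phi124 = 1],
    [phi134 = 1] and [phi234 = 1] for the affine equations satisfied by [X] when
    [F + X] is in the respective plane. Then [phi234 - phi123] is a combination
    of [phi124 - phi123] and [phi134 - phi123]; this uses that [p14], [p24] and
    [p34] are collinear ([r1] in the proof) and that [phi123] does not take the
    value 1 at [p14], which is the non-coplanarity of [f12, f13, f23, f14]. *)
Lemma cox F p12 p13 p23 p14 p24 p34 X :
  det4 F p12 p13 p23 != 0 -> det4 F p12 p14 p24 != 0 -> det4 F p13 p14 p34 != 0 ->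
  p14 \in (<[p12]> + <[p13]>)%VS -> p24 \in (<[p12]> + <[p23]>)%VS ->
  p34 \in (<[p13]> + <[p23]>)%VS -> p34 \in (<[p14]> + <[p24]>)%VS ->
  (exists a b c, X = a *: p12 + b *: p13 + c *: p23) ->
  det4 (F + p12) (F + p13) (F + p23) (F + p14) != 0 ->
  det4 (F + p12) (F + p13) (F + p23) (F + X) = 0 ->
  det4 (F + p12) (F + p14) (F + p24) (F + X) = 0 ->
  det4 (F + p13) (F + p14) (F + p34) (F + X) = 0 ->
  det4 (F + p23) (F + p24) (F + p34) (F + X) = 0.
Proof.
move=> n123 n124 n134 /mem_span2P[d3 [d2 e14]] /mem_span2P[x3 [x1 e24]].
move=> /mem_span2P[g2 [g1 e34]].
move=> /mem_span2P[m [n e34']] [X3 [X2 [X1 eX]]] nB h1 h2 h3.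
(* The line [f4] through [p14] and [p24] also contains [p34]. *)
have [r1 r2 r3] : [/\ m * d3 + n * x3 = 0, m * d2 - g2 = 0 & n * x1 - g1 = 0].
  apply: (det4_indep3 n123); rewrite scalerBl scalerBl -[RHS](subrr p34) {1}e34' e34 e14 e24.
  by vec_ring.
(* All determinants are computed in the coordinates of the basis [G]. *)
pose G := rows4 p23 p13 p12 F.
have E a b c d v : v = a *: p23 + b *: p13 + c *: p12 + d *: F -> v = row4 a b c d *m G.
  by rewrite row4_mulmx.
have E12 : F + p12 = row4 0 0 1 1 *m G by apply: E; vec_ring.
have E13 : F + p13 = row4 0 1 0 1 *m G by apply: E; vec_ring.
have E23 : F + p23 = row4 1 0 0 1 *m G by apply: E; vec_ring.
have E14 : F + p14 = row4 0 d2 d3 1 *m G by apply: E; rewrite e14; vec_ring.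
have E24 : F + p24 = row4 x1 0 x3 1 *m G by apply: E; rewrite e24; vec_ring.
have E34 : F + p34 = row4 g1 g2 0 1 *m G by apply: E; rewrite e34; vec_ring.
have EX : F + X = row4 X1 X2 X3 1 *m G by apply: E; rewrite eX; vec_ring.
have D12 : p12 = row4 0 0 1 0 *m G by apply: E; vec_ring.
have D13 : p13 = row4 0 1 0 0 *m G by apply: E; vec_ring.
have D14 : p14 = row4 0 d2 d3 0 *m G by apply: E; rewrite e14; vec_ring.
have D24 : p24 = row4 x1 0 x3 0 *m G by apply: E; rewrite e24; vec_ring.
have D34 : p34 = row4 g1 g2 0 0 *m G by apply: E; rewrite e34; vec_ring.
have DF : F = row4 0 0 0 1 *m G by apply: E; vec_ring.
have nzG : \det G != 0.
  by rewrite -det4E -oppr_eq0 (_ : - _ = - det4 F p12 p13 p23); [rewrite oppr_eq0|det4_ring].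
move: nB h1 h2 h3 n124 n134.
rewrite E12 E13 E23 E14 E24 E34 EX !det4_mulmx.
rewrite DF D12 D13 D14 D24 D34 !det4_mulmx.
rewrite !mulf_eq0 !(negPf nzG) !orbF.
have cancel k : k * \det G = 0 -> k = 0.
  by move/eqP; rewrite mulf_eq0 (negPf nzG) orbF => /eqP.
have eg2 : g2 = m * d2 by apply/esym/eqP; rewrite -subr_eq0 r2.
have eg1 : g1 = n * x1 by apply/esym/eqP; rewrite -subr_eq0 r3.
rewrite eg1 eg2 => nB /cancel h1 /cancel h2 /cancel h3 nx ng.
have {}h1 : X3 = 1 - X1 - X2.
  apply/eqP; rewrite -subr_eq0 -h1.
  by apply/eqP; rewrite /det4 /plucker_pairing !pluckerE !mxE /=; ring.
have {}nB : 1 - d2 - d3 != 0.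
  apply: contraNneq nB => B0; apply/eqP; rewrite -oppr0 -[in RHS]B0.
  by rewrite /det4 /plucker_pairing !pluckerE !mxE /=; ring.
have nz1 : x1 != 0.
  apply: contraNneq nx => ->; apply/eqP.
  by rewrite /det4 /plucker_pairing !pluckerE !mxE /=; ring.
have nz2 : n * x1 != 0.
  apply: contraNneq ng => ->; apply/eqP.
  by rewrite /det4 /plucker_pairing !pluckerE !mxE /=; ring.
have {}h2 : (1 - x1 - x3) * d2 * X1 + (1 - d2 - d3) * x1 * X2 = 0.
  rewrite -h2 h1 /det4 /plucker_pairing !pluckerE !mxE /=; ring.
have {}h3 : (1 - n * x1 - m * d2) * d3 * X1 + (1 - d2 - d3) * (n * x1) * X3 = 0.
  rewrite -[RHS]oppr0 -h3 h1 /det4 /plucker_pairing !pluckerE !mxE /=; ring.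
have -> : det4 (row4 1 0 0 1) (row4 x1 0 x3 1) (row4 (n * x1) (m * d2) 0 1) (row4 X1 X2 X3 1)
  = (1 - n * x1 - m * d2) * x3 * X2 + (1 - x1 - x3) * (m * d2) * X3.
  by rewrite h1 /det4 /plucker_pairing !pluckerE !mxE /=; ring.
suff -> : (1 - n * x1 - m * d2) * x3 * X2 + (1 - x1 - x3) * (m * d2) * X3 = 0.
  by rewrite mul0r.
(* Eliminate [X2] by [h2] and [X3] by [h3]; the remainder is divisible by the
   collinearity relation [r1]. *)
apply: (mulfI nB); apply: (mulfI nz2); apply: (mulfI nz1).
rewrite [LHS](_ : _ = (1 - n * x1 - m * d2) * x3 * (n * x1)
     * ((1 - x1 - x3) * d2 * X1 + (1 - d2 - d3) * x1 * X2)
   + (1 - x1 - x3) * (m * d2) * x1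
     * ((1 - n * x1 - m * d2) * d3 * X1 + (1 - d2 - d3) * (n * x1) * X3)
   - (1 - x1 - x3) * (1 - n * x1 - m * d2) * X1 * d2 * x1 * (m * d3 + n * x3)).
  by rewrite h2 h3 r1 !mulr0; ring.
by ring.
Qed.

End Cubes.

(** * Completing the 4-cube *)

Section Completion.
Variable K : fieldType.
Local Notation vec := 'rV[K]_4.
Implicit Types (p q r s X F : vec) (h : {vspace vec}) (V : {vspace vec}).

Lemma chord_shift V p q s : q - p \in V -> (s - q \in V) = (s - p \in V).
Proof. by move=> qp; rewrite -(rpredDr _ qp) addrA subrK. Qed.

Lemma chord_sym V p q : (p - q \in V) = (q - p \in V).
Proof. by rewrite -memvN opprB. Qed.

(** The hypotheses on [s] and on [q] are certificates: [s - p] distinguishes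
    the lines [l] and [m], and the line [n] distinguishes [X] from [p]. *)
Lemma cube4_tile h F (A B : point K) (l m n : line K) p X q s :
  F \notin h -> p \in h -> X \in h -> (l <= h)%VS -> (m <= h)%VS ->
  space_of A = <[F + p]>%VS -> space_of B = <[F + X]>%VS ->
  X - p \in space_of l -> X - p \in space_of m ->
  s - p \in space_of m -> s - p \notin space_of l ->
  X - q \in space_of n -> p - q \notin space_of n ->
  coherent A l B m.
Proof.
move=> nF ph Xh lh mh EA EB Xl Xm sm sl Xn pn.
apply: (tile_intro nF ph Xh) => //; first by move=> lm; rewrite lm sm in sl.
by move=> pX; rewrite pX Xn in pn.
Qed.

(** The lines [l] and [m] meet only at [X - p], so the vertex opposite to
    [<F + p>] is on the line through [<F + p>] and [<F + X>]. A priori it may be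
    on [h], whence a generator with an arbitrary coefficient at [F + X]. *)
Lemma tile_opposite h F (A B : point K) (l m : line K) p X :
  F \notin h -> p \in h -> X \in h -> (l <= h)%VS ->
  space_of A = <[F + p]>%VS -> X <> p ->
  X - p \in space_of l -> X - p \in space_of m -> coherent A l B m ->
  exists a b, space_of B = <[a *: (F + X) + b *: (X - p)]>%VS.
Proof.
move=> nF ph Xh lh EA nXp Xl Xm [_ nlm _ [P [Pl Pm]]].
have [y nzy EB] := pointE B; have [r nzr EP] := pointE P.
move: Pl Pm; rewrite EA EB EP -!memvE => rl rm /mem_span2P[a [b er]].
have nzX : X - p != 0 by rewrite subr_eq0; apply/eqP.
have [k ek] := meet_uniq nlm nzX Xl Xm rl rm.
have nzb : b != 0.
  apply: contraNneq nzr => b0; rewrite er b0 scale0r addr0.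
  suff -> : a = 0 by rewrite scale0r.
  apply: (@chart_coef _ h F _ (a *: p)); rewrite ?memvZ // -scalerDr.
  by move: rl; rewrite er b0 scale0r addr0; apply: (subvP lh).
exists (- (b^-1 * a)), (b^-1 * (k + a)); congr (<[_]>%VS).
apply: (scalerI nzb); rewrite scalerDr !scalerA mulrN !mulrA divff // !mul1r.
have -> : b *: y = r - a *: (F + p) by rewrite er addrC addKr.
by rewrite ek; vec_ring.
Qed.

(** Existence holds because [X - pij] is on the two lines at [fij], for all six
    pairs. For uniqueness, the tiles at [f12] and [f13] put the vertex on two
    lines through [<F + X>], and these differ since [p12 - p13] is not on
    [f134]. *)
Lemma cube4_completion (c : config K) h F p12 p13 p14 p23 p24 p34 X
    (f123 f124 f134 f234 : line K) :
  F \notin h ->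
  [/\ p12 \in h, p13 \in h & p14 \in h] -> [/\ p23 \in h, p24 \in h & p34 \in h] ->
  X \in h ->
  [/\ space_of (f12 c) = <[F + p12]>%VS, space_of (f13 c) = <[F + p13]>%VS
    & space_of (f14 c) = <[F + p14]>%VS] ->
  [/\ space_of (f23 c) = <[F + p23]>%VS, space_of (f24 c) = <[F + p24]>%VS
    & space_of (f34 c) = <[F + p34]>%VS] ->
  space_of f123 = (<[p13 - p12]> + <[p23 - p12]>)%VS ->
  space_of f124 = (<[p14 - p12]> + <[p24 - p12]>)%VS ->
  space_of f134 = (<[p14 - p13]> + <[p34 - p13]>)%VS ->
  space_of f234 = (<[p24 - p23]> + <[p34 - p23]>)%VS ->
  [/\ X - p12 \in space_of f123, X - p12 \in space_of f124,
      X - p13 \in space_of f134 & X - p23 \in space_of f234] ->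
  [/\ p14 - p12 \notin space_of f123, p24 - p12 \notin space_of f123
    & p34 - p12 \notin space_of f123] ->
  p13 - p12 \notin space_of f124 -> p23 - p12 \notin space_of f124 ->
  p12 - p13 \notin space_of f134 -> p23 - p13 \notin space_of f134 ->
  exists! f1234 : point K, completes4 c f123 f124 f134 f234 f1234.
Proof.
move=> nF [h12 h13 h14] [h23 h24 h34] hX [E12 E13 E14] [E23 E24 E34].
move=> e123 e124 e134 e234 [x123 x124 x134 x234] [o14 o24 o34] o13 o23 o12 o23'.
have sub p q (l : line K) : p \in h -> q \in h ->
    space_of l = (<[p]> + <[q]>)%VS -> (l <= h)%VS.
  by move=> ph qh ->; rewrite subv_add -!memvE ph.
have [s123 s124 s134 s234] :
    [/\ (f123 <= h)%VS, (f124 <= h)%VS, (f134 <= h)%VS & (f234 <= h)%VS].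
  by split; [move: e123|move: e124|move: e134|move: e234]; apply: sub; rewrite rpredB.
have m := (mem_span2l, mem_span2r).
have [a13 a23] : p13 - p12 \in space_of f123 /\ p23 - p12 \in space_of f123.
  by rewrite e123 !m.
have [b14 b24] : p14 - p12 \in space_of f124 /\ p24 - p12 \in space_of f124.
  by rewrite e124 !m.
have [c14 c34] : p14 - p13 \in space_of f134 /\ p34 - p13 \in space_of f134.
  by rewrite e134 !m.
have [d24 d34] : p24 - p23 \in space_of f234 /\ p34 - p23 \in space_of f234.
  by rewrite e234 !m.
have nzX : F + X != 0 by apply: chart_neq0 hX.
have [Y EY] := point_ex nzX.
exists Y; split.
  split; split.
  - by apply: (cube4_tile nF h12 hX s123 s124 E12 EY x123 x124 b14 o14 x134 o12).
  - by apply: (cube4_tile (s := p14) nF h13 hX s123 s134 E13 EY _ x134 c14 _ x124 o13);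
      rewrite (chord_shift _ a13).
  - by apply: (cube4_tile (s := p13) nF h14 hX s124 s134 E14 EY _ _ _ _ x123 o14);
      rewrite ?(chord_shift _ b14) ?(chord_shift _ c14) ?subrr ?mem0v.
  - by apply: (cube4_tile (s := p24) nF h23 hX s123 s234 E23 EY _ x234 d24 _ x124 o23);
      rewrite (chord_shift _ a23).
  - by apply: (cube4_tile (s := p23) nF h24 hX s124 s234 E24 EY _ _ _ _ x123 o24);
      rewrite ?(chord_shift _ b24) ?(chord_shift _ d24) ?subrr ?mem0v.
  - by apply: (cube4_tile (s := p23) nF h34 hX s134 s234 E34 EY _ _ _ _ x123 o34);
      rewrite ?(chord_shift _ c34) ?(chord_shift _ d34) ?subrr ?mem0v.
move=> Z [[t12 t13 _] _].
have nX12 : X <> p12 by move=> eX; move: o12; rewrite -eX x134.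
have nX13 : X <> p13 by move=> eX; move: o13; rewrite -eX x124.
have x13 : X - p13 \in space_of f123 by rewrite (chord_shift _ a13).
have [a [b EZ]] := tile_opposite nF h12 hX s123 E12 nX12 x123 x124 t12.
have [a' [b' EZ']] := tile_opposite nF h13 hX s123 E13 nX13 x13 x134 t13.
have /vlineP[k e] : a *: (F + X) + b *: (X - p12)
    \in <[a' *: (F + X) + b' *: (X - p13)]>%VS.
  by rewrite -EZ' EZ memv_line.
(* Compare the coefficients of [F], then the components in [h]. *)
have ek : a - k * a' = 0.
  apply: (@chart_coef _ h F _
    ((a - k * a') *: X + b *: (X - p12) - (k * b') *: (X - p13))) => //.
    by rewrite rpredB ?rpredD ?memvZ ?rpredB.
  rewrite -[_ + _](_ : a *: (F + X) + b *: (X - p12)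
                      - k *: (a' *: (F + X) + b' *: (X - p13)) = _); last by vec_ring.
  by rewrite e subrr mem0v.
have b0 : b = 0.
  apply/eqP/negP=> /negP nzb; move: o12; rewrite -(chord_shift _ x134) chord_sym.
  rewrite -[X - p12](scalerK nzb) (_ : b *: (X - p12) = (k * b') *: (X - p13)) ?memvZ //.
  have -> : b *: (X - p12) = a *: (F + X) + b *: (X - p12) - a *: (F + X) by vec_ring.
  rewrite e; have -> : a = k * a' by apply/eqP; rewrite -subr_eq0 ek.
  by vec_ring.
move: EZ; rewrite b0 scale0r addr0 => EZ.
apply: subspace_eq; apply/eqP; rewrite eq_sym eqEdim !dim_subspace leqnn andbT.
by rewrite EZ EY -memvE memvZ ?memv_line.
Qed.

End Completion.

(** * The generic locus *)

Section Generic.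
Variable K : fieldType.
Local Notation vec := 'rV[K]_4.
Implicit Types (p q r s X F : vec) (h : {vspace vec}) (V : {vspace vec}).

(** The point where [l] and [m] meet lies on the line through [<F>] and [<y>].
    It differs from both, so it can be scaled to [p] with [y] proportional to
    [F + p]. *)
Lemma tile_center (A B : point K) (l m : line K) F y :
  space_of A = <[F]>%VS -> space_of B = <[y]>%VS -> coherent A l B m ->
  exists k p, [/\ k != 0, p != 0, y = k *: (F + p), p \in space_of l
                & p \in space_of m].
Proof.
move=> EA EB [_ _ [nAl _ nBl _] [P [Pl Pm PAB]]].
have [r nzr EP] := pointE P.
move: Pl Pm PAB nAl nBl.
rewrite EA EB EP -!memvE => rl rm /mem_span2P[a [b er]] nFl nyl.
have nza : a != 0.
  apply: contraNneq nyl => a0; move: er; rewrite a0 scale0r add0r => er.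
  have nzb : b != 0 by apply: contraNneq nzr => b0; rewrite er b0 scale0r.
  by rewrite -[y](scalerK nzb) -er memvZ.
have nzb : b != 0.
  apply: contraNneq nFl => b0; move: er; rewrite b0 scale0r addr0 => er.
  by rewrite -[F](scalerK nza) -er memvZ.
exists (- (b^-1 * a)), (- a^-1 *: r); split; rewrite ?memvZ //.
- by rewrite oppr_eq0 mulf_neq0 ?invr_eq0.
- by rewrite scaler_eq0 negb_or oppr_eq0 invr_eq0 nza.
apply: (scalerI nzb); rewrite scalerA mulrN mulrA divff // mul1r scalerDr scalerA.
rewrite mulrNN divff // scale1r er scaleNr addKr //.
Qed.

Lemma completes3_unique h F (fi fj fk : line K) (fij fik fjk : point K) p q r :
  F \notin h -> p \in h -> q \in h -> r \in h -> det4 F p q r != 0 ->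
  space_of fi = (<[p]> + <[q]>)%VS -> space_of fj = (<[p]> + <[r]>)%VS ->
  space_of fk = (<[q]> + <[r]>)%VS ->
  space_of fij = <[F + p]>%VS -> space_of fik = <[F + q]>%VS ->
  space_of fjk = <[F + r]>%VS ->
  exists! l, completes3 fi fj fk fij fik fjk l.
Proof.
move=> nF ph qh rh nz Ei Ej Ek Eij Eik Ejk.
have C l := completes3P l nF ph qh rh nz Ei Ej Ek Eij Eik Ejk.
have [|l El] := @line_ex K (q - p) (r - p).
  move=> a b rel.
  have [|_ -> -> //] := @det4_indep3 _ F p q r (- a - b) a b nz.
  by rewrite -[RHS]rel; vec_ring.
exists l; split; first exact/C.
by move=> l' /C El'; apply: subspace_eq; rewrite El.
Qed.

Lemma det4_full V x y z w v : det4 x y z w != 0 ->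
  x \in V -> y \in V -> z \in V -> w \in V -> v \in V.
Proof.
move=> nz xV yV zV wV; rewrite -[v](scalerK nz) cramer4.
by rewrite memvZ // !rpredD ?memvZ.
Qed.

Lemma det4_scale a b c d x y z w :
  det4 (a *: x) (b *: y) (c *: z) (d *: w) = a * b * c * d * det4 x y z w :> K.
Proof. by det4_ring. Qed.

Lemma det4_chart F a b c p q r :
  det4 F (a *: (F + p)) (b *: (F + q)) (c *: (F + r)) = a * b * c * det4 F p q r.
Proof. by det4_ring. Qed.

(** The common point of three planes in closed form: [z] is where the line
    [(q13 q23)] meets the plane [(q12 q14 q24)], so the line [(q12 z)] is common
    to this plane and to [(q12 q13 q23)]; the result is where that line meets
    [(q13 q14 q34)]. For the points [fij] of a configuration this is [f1234],
    as a polynomial in the homogeneous coordinates. *)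
Definition cox_point (q12 q13 q14 q23 q24 q34 : vec) : vec :=
  let z := det4 q12 q14 q24 q23 *: q13 - det4 q12 q14 q24 q13 *: q23 in
  det4 q13 q14 q34 z *: q12 - det4 q13 q14 q34 q12 *: z.

(** The plane of the lines [f1] and [f2] is only available through Plücker
    coordinates. A row of [L2] is a vector of [f2], so the last factor is the
    determinant of two generators of [f1], a vector of [f2] and the candidate
    for [f1234]: it detects that this candidate is off the plane. The row [i2]
    is one for which the factor does not vanish identically. *)
Definition genericity_of (F q12 q13 q14 q23 q24 q34 : vec) (L1 L2 : 'M[K]_4) : K :=
  (det4 F q12 q13 q23 * det4 F q12 q14 q24 * det4 F q13 q14 q34 * det4 F q23 q24 q34)
  * (det4 q12 q13 q23 q14 * det4 q12 q13 q23 q24 * det4 q12 q13 q23 q34)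
  * (det4 q12 q14 q24 q13 * det4 q12 q14 q24 q23)
  * (det4 q13 q14 q34 q12 * det4 q13 q14 q34 q23)
  * plucker_pairing L1 (row i2 L2) (cox_point q12 q13 q14 q23 q24 q34).

Local Notation idx7 k := (@Ordinal 7 k isT).

Definition genericity (P : 'I_7 -> vec) (L : 'I_4 -> 'M[K]_4) : K :=
  genericity_of (P (idx7 0)) (P (idx7 1)) (P (idx7 2)) (P (idx7 3)) (P (idx7 4))
    (P (idx7 5)) (P (idx7 6)) (L i0) (L i1).

Lemma det4_sub x y z a v b w :
  det4 x y z (a *: v - b *: w) = a * det4 x y z v - b * det4 x y z w :> K.
Proof. by rewrite -scaleNr det4_comb mulNr. Qed.

Lemma cox_pointP q12 q13 q14 q23 q24 q34 (W := cox_point q12 q13 q14 q23 q24 q34) :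
  [/\ det4 q12 q13 q23 W = 0, det4 q12 q14 q24 W = 0 & det4 q13 q14 q34 W = 0].
Proof.
have r x y z : (det4 x y z x = 0) * (det4 x y z y = 0) * (det4 x y z z = 0) :> Prop.
  by have [-> -> ->] := det4_repeat x y z.
rewrite /W /cox_point; split; rewrite !det4_sub !r; ring.
Qed.

Definition cube_completable (c : config K) : Prop :=
    [/\ exists! l, completes3 (f1 c) (f2 c) (f3 c) (f12 c) (f13 c) (f23 c) l,
        exists! l, completes3 (f1 c) (f2 c) (f4 c) (f12 c) (f14 c) (f24 c) l,
        exists! l, completes3 (f1 c) (f3 c) (f4 c) (f13 c) (f14 c) (f34 c) l
      & exists! l, completes3 (f2 c) (f3 c) (f4 c) (f23 c) (f24 c) (f34 c) l] /\
    forall f123 f124 f134 f234 : line K,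
      completes3 (f1 c) (f2 c) (f3 c) (f12 c) (f13 c) (f23 c) f123 ->
      completes3 (f1 c) (f2 c) (f4 c) (f12 c) (f14 c) (f24 c) f124 ->
      completes3 (f1 c) (f3 c) (f4 c) (f13 c) (f14 c) (f34 c) f134 ->
      completes3 (f2 c) (f3 c) (f4 c) (f23 c) (f24 c) (f34 c) f234 ->
      exists! f1234 : point K, completes4 c f123 f124 f134 f234 f1234.

(** After rescaling each [fij] to [F + pij], the factors of [genericity] become
    the non-vanishing determinants asked for by [completes3P], [cox] and
    [cube4_completion]. *)
Lemma genericity_completable (c : config K) P L :
  admissible c -> hom_coords c P L -> genericity P L != 0 -> cube_completable c.
Proof.
move=> [[t12 t13 t14] [t23 t24 t34]] [HP HL].
have EF : space_of (f_ c) = <[P (idx7 0)]>%VS := HP (idx7 0).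
have E12 : space_of (f12 c) = <[P (idx7 1)]>%VS := HP (idx7 1).
have E13 : space_of (f13 c) = <[P (idx7 2)]>%VS := HP (idx7 2).
have E14 : space_of (f14 c) = <[P (idx7 3)]>%VS := HP (idx7 3).
have E23 : space_of (f23 c) = <[P (idx7 4)]>%VS := HP (idx7 4).
have E24 : space_of (f24 c) = <[P (idx7 5)]>%VS := HP (idx7 5).
have E34 : space_of (f34 c) = <[P (idx7 6)]>%VS := HP (idx7 6).
have [u1 [v1 [eu1 eL1]]] : exists u v, space_of (f1 c) = (<[u]> + <[v]>)%VS
  /\ L i0 = plucker u v := HL i0.
have [u2 [v2 [eu2 eL2]]] : exists u v, space_of (f2 c) = (<[u]> + <[v]>)%VS
  /\ L i1 = plucker u v := HL i1.
rewrite /genericity eL1 eL2; clear HP HL eL1 eL2.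
move: (P (idx7 0)) (P (idx7 1)) (P (idx7 2)) (P (idx7 3)) (P (idx7 4)) (P (idx7 5))
  (P (idx7 6)) EF E12 E13 E14 E23 E24 E34 => F q12 q13 q14 q23 q24 q34.
move=> EF E12 E13 E14 E23 E24 E34.
have [k12 [p12 [nk12 _ eq12 p12_1 p12_2]]] := tile_center EF E12 t12.
have [k13 [p13 [nk13 _ eq13 p13_1 p13_3]]] := tile_center EF E13 t13.
have [k14 [p14 [nk14 _ eq14 p14_1 p14_4]]] := tile_center EF E14 t14.
have [k23 [p23 [nk23 _ eq23 p23_2 p23_3]]] := tile_center EF E23 t23.
have [k24 [p24 [nk24 _ eq24 p24_2 p24_4]]] := tile_center EF E24 t24.
have [k34 [p34 [nk34 _ eq34 p34_3 p34_4]]] := tile_center EF E34 t34.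
have [z1 z2 z3] := cox_pointP q12 q13 q14 q23 q24 q34.
rewrite /genericity_of; set W := cox_point _ _ _ _ _ _ in z1 z2 z3 *.
have scale (k : K) (A : point K) q p : k != 0 -> q = k *: (F + p) ->
    space_of A = <[q]>%VS -> space_of A = <[F + p]>%VS.
  move=> nk -> ->; apply/eqP; rewrite eqEdim -memvE memvZ ?memv_line //=.
  rewrite !dim_vline scaler_eq0 (negPf nk) //.
have {}E12 := scale _ _ _ _ nk12 eq12 E12.
have {}E13 := scale _ _ _ _ nk13 eq13 E13.
have {}E14 := scale _ _ _ _ nk14 eq14 E14.
have {}E23 := scale _ _ _ _ nk23 eq23 E23.
have {}E24 := scale _ _ _ _ nk24 eq24 E24.
have {}E34 := scale _ _ _ _ nk34 eq34 E34.
rewrite eq12 eq13 eq14 eq23 eq24 eq34 !det4_chart !det4_scale.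
rewrite !mulf_eq0 !negb_or -!andbA nk12 nk13 nk14 nk23 nk24 nk34 /=.
case/and5P=> n123 n124 n134 n234 /and5P[o14 o24 o34 o13 /and4P[o23 o12 o23' nW]].
have span2 (l : line K) p q r : p \in space_of l -> q \in space_of l ->
    det4 F p q r != 0 -> space_of l = (<[p]> + <[q]>)%VS.
  by move=> pl ql nz; apply: lineE_in (det4_indep2 nz).
have rot := @det4_rotr K F; have swap := @det4_transp K F.
have e1 := span2 _ _ _ _ p12_1 p13_1 n123.
have e2 := span2 _ _ _ _ p12_2 p23_2 (rot _ _ _ (swap _ _ _ n123)).
have e3 := span2 _ _ _ _ p13_3 p23_3 (rot _ _ _ n123).
have e1' := span2 _ _ _ _ p12_1 p14_1 n124.
have e2' := span2 _ _ _ _ p12_2 p24_2 (rot _ _ _ (swap _ _ _ n124)).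
have e4 := span2 _ _ _ _ p14_4 p24_4 (rot _ _ _ n124).
have e1'' := span2 _ _ _ _ p13_1 p14_1 n134.
have e3' := span2 _ _ _ _ p13_3 p34_3 (rot _ _ _ (swap _ _ _ n134)).
have e4' := span2 _ _ _ _ p14_4 p34_4 (rot _ _ _ n134).
have e2'' := span2 _ _ _ _ p23_2 p24_2 n234.
have e3'' := span2 _ _ _ _ p23_3 p34_3 (rot _ _ _ (swap _ _ _ n234)).
have e4'' := span2 _ _ _ _ p24_4 p34_4 (rot _ _ _ n234).
pose h := (<[p12]> + <[p13]> + <[p23]>)%VS.
have memh x : reflect (exists a b c, x = a *: p12 + b *: p13 + c *: p23) (x \in h).
  apply: (iffP memv_addP) => [[_ /mem_span2P[a [b ->]] [_ /vlineP[d ->] ->]]|[a [b [d ->]]]].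
    by exists a, b, d.
  exists (a *: p12 + b *: p13); first by apply/mem_span2P; exists a, b.
  by exists (d *: p23); rewrite ?memvZ ?memv_line.
have nF : F \notin h.
  apply/negP=> /memh[a [b [d eF]]].
  have [|/eqP] := @det4_indep _ F p12 p13 p23 1 (- a) (- b) (- d) n123.
    by rewrite {1}eF; vec_ring.
  by rewrite oner_eq0.
have h12 : p12 \in h by apply/memh; exists 1, 0, 0; vec_ring.
have h13 : p13 \in h by apply/memh; exists 0, 1, 0; vec_ring.
have h23 : p23 \in h by apply/memh; exists 0, 0, 1; vec_ring.
have sub p q (l : line K) : p \in h -> q \in h ->
    space_of l = (<[p]> + <[q]>)%VS -> (l <= h)%VS.
  by move=> ph qh ->; rewrite subv_add -!memvE ph.
have s1 := sub _ _ _ h12 h13 e1.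
have s2 := sub _ _ _ h12 h23 e2.
have s3 := sub _ _ _ h13 h23 e3.
have h14 := subvP s1 _ p14_1.
have h24 := subvP s2 _ p24_2.
have h34 := subvP s3 _ p34_3.
have C123 l := @completes3P _ h F (f1 c) (f2 c) (f3 c) l
  _ _ _ _ _ _ nF h12 h13 h23 n123 e1 e2 e3 E12 E13 E23.
have C124 l := @completes3P _ h F (f1 c) (f2 c) (f4 c) l
  _ _ _ _ _ _ nF h12 h14 h24 n124 e1' e2' e4 E12 E14 E24.
have C134 l := @completes3P _ h F (f1 c) (f3 c) (f4 c) l
  _ _ _ _ _ _ nF h13 h14 h34 n134 e1'' e3' e4' E13 E14 E34.
have C234 l := @completes3P _ h F (f2 c) (f3 c) (f4 c) l
  _ _ _ _ _ _ nF h23 h24 h34 n234 e2'' e3'' e4'' E23 E24 E34.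
split.
  split.
  - exact: completes3_unique nF h12 h13 h23 n123 e1 e2 e3 E12 E13 E23.
  - exact: completes3_unique nF h12 h14 h24 n124 e1' e2' e4 E12 E14 E24.
  - exact: completes3_unique nF h13 h14 h34 n134 e1'' e3' e4' E13 E14 E34.
  - exact: completes3_unique nF h23 h24 h34 n234 e2'' e3'' e4'' E23 E24 E34.
move=> f123 f124 f134 f234 /C123 e123 /C124 e124 /C134 e134 /C234 e234.
have nWh : W \notin h.
  apply/negP=> Wh; case/negP: nF; apply: (det4_full _ nW) => //.
  - by apply: (subvP s1); rewrite eu1 mem_span2l.
  - by apply: (subvP s1); rewrite eu1 mem_span2r.
  - apply: (subvP s2); rewrite eu2; apply/mem_span2P; exists (- v2 0 i2), (u2 0 i2).
    by apply/rowP=> j; rewrite mxE pluckerE !mxE; ring.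
(* Off [h], the Cox point belongs to the chart. *)
have [a [X [nza Xh eW]]] : exists a X, [/\ a != 0, X \in h & W = a *: (F + X)].
  have [a [x [xh eW]]] : exists a x, x \in h /\ W = a *: F + x.
    exists ((det4 F p12 p13 p23)^-1 * det4 W p12 p13 p23).
    eexists; split; last first.
      by rewrite -[LHS](scalerK n123) cramer4 -!addrA scalerDr scalerA; reflexivity.
    by rewrite memvZ // !rpredD ?memvZ.
  have nza : a != 0 by apply: contraNneq nWh => a0; rewrite eW a0 scale0r add0r.
  by exists a, (a^-1 *: x); rewrite memvZ // scalerDr scalerA divff // scale1r.
have z b d e q r s : b != 0 -> d != 0 -> e != 0 ->
    det4 (b *: (F + q)) (d *: (F + r)) (e *: (F + s)) W = 0 ->
    det4 (F + q) (F + r) (F + s) (F + X) = 0.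
  move=> nb nd ne; rewrite eW det4_scale => /eqP.
  by rewrite !mulf_eq0 (negPf nb) (negPf nd) (negPf ne) (negPf nza) => /eqP.
rewrite eq12 eq13 eq23 in z1; rewrite eq12 eq14 eq24 in z2; rewrite eq13 eq14 eq34 in z3.
have {}z1 := z _ _ _ _ _ _ nk12 nk13 nk23 z1.
have {}z2 := z _ _ _ _ _ _ nk12 nk14 nk24 z2.
have {}z3 := z _ _ _ _ _ _ nk13 nk14 nk34 z3.
have z4 : det4 (F + p23) (F + p24) (F + p34) (F + X) = 0.
  rewrite e1 in p14_1; rewrite e2 in p24_2; rewrite e3 in p34_3; rewrite e4 in p34_4.
  exact: (cox n123 n124 n134 p14_1 p24_2 p34_3 p34_4 (memh _ Xh) o14 z1 z2 z3).
apply: (cube4_completion nF (And3 h12 h13 h14) (And3 h23 h24 h34) Xh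
  (And3 E12 E13 E14) (And3 E23 E24 E34) e123 e124 e134 e234).
- by split; rewrite ?e123 ?e124 ?e134 ?e234; apply: (chord_in nF).
- by rewrite e123; split; [exact: (chord_notin o14)|exact: (chord_notin o24)
    |exact: (chord_notin o34)].
- by rewrite e124; exact: (chord_notin o13).
- by rewrite e124; exact: (chord_notin o23).
- by rewrite e134; exact: (chord_notin o12).
- by rewrite e134; exact: (chord_notin o23').
Qed.

End Generic.

(** * Polynomial functions *)

Section PolyFun.
Variable K : fieldType.

(** The functions on [T] that are polynomial expressions in the generators [X].
    Generators are either all coordinates on a finite product, which gives
    multivariate polynomials, or the identity of [K], which gives polynomials in
    one variable; the closure lemmas are shared. *)
Inductive poly_fun (T I : Type) (X : I -> T -> K) : (T -> K) -> Prop :=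
| PolyConst k : poly_fun X (fun=> k)
| PolyGen i : poly_fun X (X i)
| PolyAdd f g : poly_fun X f -> poly_fun X g -> poly_fun X (fun t => f t + g t)
| PolyMul f g : poly_fun X f -> poly_fun X g -> poly_fun X (fun t => f t * g t)
| PolyExt f g : poly_fun X f -> f =1 g -> poly_fun X g.

Section Closure.
Variables (T I : Type) (X : I -> T -> K).
Local Notation pf := (poly_fun X).

Lemma poly_fun_opp f : pf f -> pf (fun t => - f t).
Proof.
move=> pf_f; apply: (PolyExt (PolyMul (PolyConst X (-1)) pf_f)) => t.
exact: mulN1r.
Qed.

Lemma poly_fun_sub f g : pf f -> pf g -> pf (fun t => f t - g t).
Proof. by move=> pf_f pf_g; apply: PolyAdd (poly_fun_opp pf_g). Qed.

Lemma poly_fun_sum J (r : seq J) (f : J -> T -> K) :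
  (forall j, pf (f j)) -> pf (fun t => \sum_(j <- r) f j t).
Proof.
move=> pf_f; elim: r => [|j r IHr].
  by apply: (PolyExt (PolyConst X 0)) => t; rewrite big_nil.
by apply: (PolyExt (PolyAdd (pf_f j) IHr)) => t; rewrite big_cons.
Qed.

Lemma poly_fun_prod J (r : seq J) (f : J -> T -> K) :
  (forall j, pf (f j)) -> pf (fun t => \prod_(j <- r) f j t).
Proof.
move=> pf_f; elim: r => [|j r IHr].
  by apply: (PolyExt (PolyConst X 1)) => t; rewrite big_nil.
by apply: (PolyExt (PolyMul (pf_f j) IHr)) => t; rewrite big_cons.
Qed.

Lemma poly_fun_exp f n : pf f -> pf (fun t => f t ^+ n).
Proof.
move=> pf_f; elim: n => [|n IHn].
  by apply: (PolyExt (PolyConst X 1)) => t; rewrite expr0.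
by apply: (PolyExt (PolyMul pf_f IHn)) => t; rewrite exprS.
Qed.

Definition poly_mx m n (M : T -> 'M[K]_(m, n)) :=
  forall i j, pf (fun t => M t i j).

Lemma poly_mx_const m n (A : 'M[K]_(m, n)) : poly_mx (fun=> A).
Proof. by move=> i j; apply: PolyConst. Qed.

Lemma poly_mx_add m n (M N : T -> 'M[K]_(m, n)) :
  poly_mx M -> poly_mx N -> poly_mx (fun t => M t + N t).
Proof.
by move=> hM hN i j; apply: (PolyExt (PolyAdd (hM i j) (hN i j))) => t; rewrite mxE.
Qed.

Lemma poly_mx_scale m n f (M : T -> 'M[K]_(m, n)) :
  pf f -> poly_mx M -> poly_mx (fun t => f t *: M t).
Proof.
by move=> hf hM i j; apply: (PolyExt (PolyMul hf (hM i j))) => t; rewrite mxE.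
Qed.

Lemma poly_mx_sub m n (M N : T -> 'M[K]_(m, n)) :
  poly_mx M -> poly_mx N -> poly_mx (fun t => M t - N t).
Proof.
by move=> hM hN i j; apply: (PolyExt (poly_fun_sub (hM i j) (hN i j))) => t; rewrite !mxE.
Qed.

Lemma poly_mx_mul m n p (M : T -> 'M[K]_(m, n)) (N : T -> 'M[K]_(n, p)) :
  poly_mx M -> poly_mx N -> poly_mx (fun t => M t *m N t).
Proof.
move=> hM hN i j.
apply: (PolyExt (poly_fun_sum (index_enum 'I_n) (fun k => PolyMul (hM i k) (hN k j)))) => t.
by rewrite mxE.
Qed.

Lemma poly_mx_row m n i (M : T -> 'M[K]_(m, n)) :
  poly_mx M -> poly_mx (fun t => row i (M t)).
Proof. by move=> hM k j; apply: (PolyExt (hM i j)) => t; rewrite mxE. Qed.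

Lemma poly_mx_tr m n (M : T -> 'M[K]_(m, n)) :
  poly_mx M -> poly_mx (fun t => (M t)^T).
Proof. by move=> hM i j; apply: (PolyExt (hM j i)) => t; rewrite mxE. Qed.

Lemma poly_mx_plucker (u v : T -> 'rV[K]_4) :
  poly_mx u -> poly_mx v -> poly_mx (fun t => plucker (u t) (v t)).
Proof.
move=> hu hv; apply: poly_mx_sub; apply: poly_mx_mul => //; exact: poly_mx_tr.
Qed.

Lemma poly_fun_det n (M : T -> 'M[K]_n) : poly_mx M -> pf (fun t => \det (M t)).
Proof.
move=> hM; apply: poly_fun_sum => s; apply: PolyMul; first exact: PolyConst.
exact: poly_fun_prod.
Qed.

Lemma poly_fun_pairing (L : T -> 'M[K]_4) (w x : T -> 'rV[K]_4) :
  poly_mx L -> poly_mx w -> poly_mx x ->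
  pf (fun t => plucker_pairing (L t) (w t) (x t)).
Proof.
move=> hL hw hx; rewrite /plucker_pairing.
by do ?[apply: poly_fun_sub|apply: PolyAdd|apply: PolyMul].
Qed.

Lemma poly_fun_det4 (x y z w : T -> 'rV[K]_4) :
  poly_mx x -> poly_mx y -> poly_mx z -> poly_mx w ->
  pf (fun t => det4 (x t) (y t) (z t) (w t)).
Proof.
by move=> hx hy hz hw; apply: poly_fun_pairing => //; apply: poly_mx_plucker.
Qed.

Lemma poly_fun_genericity (P : T -> 'I_7 -> 'rV[K]_4) (L : T -> 'I_4 -> 'M[K]_4) :
  (forall i, poly_mx (fun t => P t i)) -> (forall j, poly_mx (fun t => L t j)) ->
  pf (fun t => genericity (P t) (L t)).
Proof.
move=> hP hL; rewrite /genericity /genericity_of /cox_point.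
by repeat first [apply: PolyMul|apply: poly_fun_det4|apply: poly_fun_pairing
  |apply: poly_mx_sub|apply: poly_mx_scale|apply: poly_mx_row|exact: hP|exact: hL].
Qed.

Lemma poly_fun_meval n (p : {mpoly K[n]}) (v : T -> 'I_n -> K) :
  (forall i, pf (fun t => v t i)) -> pf (fun t => p.@[v t]).
Proof.
move=> hv; apply: (@PolyExt _ _ _ (fun t =>
    \sum_(m <- msupp p) p@_m * \prod_i v t i ^+ m i)) => [|t]; last by rewrite mevalE.
apply: poly_fun_sum => m; apply: PolyMul; first exact: PolyConst.
by apply: poly_fun_prod => i; apply: poly_fun_exp.
Qed.

End Closure.

Lemma poly_fun_horner g : poly_fun (fun _ : unit => id) g ->
  exists q : {poly K}, forall t, q.[t] = g t.
Proof.
elim=> {g} [k|_|f g _ [p hp] _ [q hq]|f g _ [p hp] _ [q hq]|f g _ [p hp] fg].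
- by exists k%:P => t; rewrite hornerC.
- by exists 'X => t; rewrite hornerX.
- by exists (p + q) => t; rewrite hornerD hp hq.
- by exists (p * q) => t; rewrite hornerM hp hq.
- by exists p => t; rewrite hp.
Qed.

Lemma poly_fun_mpoly (J : finType) g : poly_fun (fun (i : J) (v : J -> K) => v i) g ->
  exists p : {mpoly K[#|J|]}, forall v, p.@[fun k => v (enum_val k)] = g v.
Proof.
elim=> {g} [k|i|f g _ [p hp] _ [q hq]|f g _ [p hp] _ [q hq]|f g _ [p hp] fg].
- by exists k%:MP => v; rewrite mevalC.
- by exists 'X_(enum_rank i) => v; rewrite mevalXU enum_rankK.
- by exists (p + q) => v; rewrite mevalD hp hq.
- by exists (p * q) => v; rewrite mevalM hp hq.
- by exists p => v; rewrite hp.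
Qed.

(** The matrices [P v] and [L v] reassemble a point [v] of the coordinate space
    into vectors and Plücker matrices. *)
Lemma genericity_mpoly : exists p : {mpoly K[#|coord_index|]}, forall P L,
  p.@[fun k => coord_val P L (enum_val k)] = genericity P L.
Proof.
pose P (v : coord_index -> K) i : 'rV[K]_4 := \row_a v (inl (i, a)).
pose L (v : coord_index -> K) j : 'M[K]_4 := \matrix_(a, b) v (inr (j, (a, b))).
have [|p hp] := @poly_fun_mpoly coord_index (fun v => genericity (P v) (L v)).
  apply: poly_fun_genericity => [i a b|j a b].
    by apply: (PolyExt (PolyGen _ (inl (i, b) : coord_index))) => v; rewrite mxE.
  by apply: (PolyExt (PolyGen _ (inr (j, (a, b)) : coord_index))) => v; rewrite mxE.
exists p => P0 L0; rewrite hp /genericity.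
have EP i : P (coord_val P0 L0) i = P0 i by apply/rowP=> a; rewrite mxE.
have EL j : L (coord_val P0 L0) j = L0 j by apply/matrixP=> a b; rewrite mxE.
by rewrite !EP !EL.
Qed.

End PolyFun.

(** * Parametrizing the coplanar configurations *)

Section Parametrization.
Variable K : fieldType.
Local Notation vec := 'rV[K]_4.
Local Notation idx7 k := (@Ordinal 7 k isT).
Implicit Types (u v x y z w p F : vec) (h : {vspace vec}).

(** Only the entries with [i < j] are meaningful. *)
Definition pair_index (i j : 'I_4) : 'I_7 :=
  nth ord0 (nth [::] [:: [:: ord0; idx7 1; idx7 2; idx7 3];
    [:: ord0; ord0; idx7 4; idx7 5]; [:: ord0; ord0; ord0; idx7 6]] i) j.

Lemma admissibleP (c : config K) : admissible c <->
  forall i j : 'I_4, (i < j)%N ->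
    coherent (f_ c) (tnth (config_lines c) i)
      (tnth (config_points c) (pair_index i j)) (tnth (config_lines c) j).
Proof.
split=> [[[t12 t13 t14] [t23 t24 t34]]|t].
  by apply: ord4P; apply: ord4P.
by split; split; [exact: (t i0 i1)|exact: (t i0 i2)|exact: (t i0 i3)
  |exact: (t i1 i2)|exact: (t i1 i3)|exact: (t i2 i3)].
Qed.

Lemma ord7P (Q : 'I_7 -> Prop) :
  Q (idx7 0) -> (forall i j : 'I_4, (i < j)%N -> Q (pair_index i j)) -> forall k, Q k.
Proof.
move=> Q0 Qij [[|[|[|[|[|[|[|//]]]]]]] ltk].
- by rewrite (_ : Ordinal ltk = idx7 0) //; apply: val_inj.
- by rewrite (_ : Ordinal ltk = pair_index i0 i1); [apply: Qij|apply: val_inj].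
- by rewrite (_ : Ordinal ltk = pair_index i0 i2); [apply: Qij|apply: val_inj].
- by rewrite (_ : Ordinal ltk = pair_index i0 i3); [apply: Qij|apply: val_inj].
- by rewrite (_ : Ordinal ltk = pair_index i1 i2); [apply: Qij|apply: val_inj].
- by rewrite (_ : Ordinal ltk = pair_index i1 i3); [apply: Qij|apply: val_inj].
- by rewrite (_ : Ordinal ltk = pair_index i2 i3); [apply: Qij|apply: val_inj].
Qed.

Definition pole : vec := row4 0 0 0 1.

Definition flat u := u 0 i3 = 0.

(** The point common to the lines [<u, v>] and [<u', v'>] of the plane of flat
    vectors: the determinants with last row [pole] are the 3 by 3 determinants
    in that plane. *)
Definition meet u v u' v' : vec := det4 u u' v' pole *: v - det4 v u' v' pole *: u.

Ltac flat_ring := rewrite /meet /pole /det4 /plucker_pairing !pluckerE !mxE /=.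

Lemma meet_in u v u' v' : meet u v u' v' \in (<[u]> + <[v]>)%VS.
Proof.
apply/mem_span2P; exists (- det4 v u' v' pole), (det4 u u' v' pole).
by rewrite /meet scaleNr addrC.
Qed.

(** Cramer's relation between the four flat vectors, which shows that [meet] is
    also on the second line. *)
Lemma meetC u v u' v' : flat u -> flat v -> flat u' -> flat v' ->
  meet u v u' v' = - meet u' v' u v.
Proof.
rewrite /flat => u3 v3 u3' v3'; apply/rowP.
by apply: ord4P; flat_ring; rewrite ?u3 ?v3 ?u3' ?v3'; ring.
Qed.

(** If both coefficients of [meet] vanish, then [u] and [v] are in the span of
    [u'] and [v'], computed in the plane of flat vectors. *)
Lemma meet_neq0 u v u' v' : flat u -> flat v -> flat u' -> flat v' ->
  indep2 u v -> indep2 u' v' ->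
  ~ (u \in (<[u']> + <[v']>)%VS /\ v \in (<[u']> + <[v']>)%VS) ->
  meet u v u' v' != 0.
Proof.
move=> fu fv fu' fv' ind ind' nsub; apply/eqP=> m0; apply: nsub.
have [|eu ev] := ind (- det4 v u' v' pole) (det4 u u' v' pole).
  by rewrite -[RHS]m0 /meet scaleNr addrC.
have ne : pole \notin (<[u']> + <[v']>)%VS.
  apply/negP=> /mem_span2P[a [b /rowP/(_ i3)]].
  by rewrite !mxE fu' fv' !mulr0 addr0 => /eqP; rewrite oner_eq0.
have [w nz] := det4_extend ne ind'.
have F x : flat x -> det4 x u' v' pole = 0 -> x \in (<[u']> + <[v']>)%VS.
  move=> fx d0; have [|a [b [c ex]]] := in_span3 (v := x) nz.
    by rewrite -[RHS]oppr0 -d0; det4_ring.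
  have a0 : a = 0.
    by move/rowP/(_ i3): (ex); rewrite !mxE fx fu' fv' !mulr0 !addr0 mulr1.
  by apply/mem_span2P; exists b, c; rewrite ex a0 scale0r add0r.
by split; apply: F => //; apply/eqP; rewrite -oppr_eq0 eu.
Qed.

Lemma meet_eq0 u v u' v' :
  u \in (<[u']> + <[v']>)%VS -> v \in (<[u']> + <[v']>)%VS -> meet u v u' v' = 0.
Proof.
move=> /mem_span2P[a [b ->]] /mem_span2P[a' [b' ->]].
by apply/rowP=> j; rewrite /meet !mxE /det4 /plucker_pairing !pluckerE !mxE; ring.
Qed.

(** The matrix [pG] carries the standard flat plane to the plane [h], where the
    line [fi] is spanned by the images of [pu i] and [pv i]. The point [fij] is
    placed on the line joining [f] to the intersection of [fi] and [fj] by the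
    coefficients [pa i j] and [pb i j]. No normalization is imposed, so that all
    choices of homogeneous coordinates of a configuration are reached. *)
Record param := Param {
  pG : 'M[K]_4; pu : 'I_4 -> vec; pv : 'I_4 -> vec; pF : vec;
  pa : 'I_4 -> 'I_4 -> K; pb : 'I_4 -> 'I_4 -> K }.

Definition param_meet s i j := meet (pu s i) (pv s i) (pu s j) (pv s j).

Definition param_pt s i j : vec :=
  pa s i j *: pF s + pb s i j *: (param_meet s i j *m pG s).

Definition param_P s : 'I_7 -> vec :=
  tnth [tuple pF s; param_pt s i0 i1; param_pt s i0 i2; param_pt s i0 i3;
    param_pt s i1 i2; param_pt s i1 i3; param_pt s i2 i3].

Definition param_L s (j : 'I_4) : 'M[K]_4 := plucker (pu s j *m pG s) (pv s j *m pG s).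

Definition param_flat s := forall i, flat (pu s i) /\ flat (pv s i).

(** The arguments [w] and [m] are witnesses chosen beforehand: with them, the
    disjunction of non-vanishing minors expressing that [f] is off each line
    and that the lines are distinct becomes a single polynomial. *)
Definition nondegeneracy s (w : 'I_4 -> vec) (m : 'I_4 * 'I_4 -> 'I_4) : K :=
  \det (pG s) * (\prod_i det4 (pF s) (pu s i *m pG s) (pv s i *m pG s) (w i)) *
  \prod_(ij : 'I_4 * 'I_4) (if (ij.1 < ij.2)%N then
     param_meet s ij.1 ij.2 0 (m ij) * (pa s ij.1 ij.2 * pb s ij.1 ij.2) else 1).

Lemma nondegeneracyP s (w : 'I_4 -> vec) m : nondegeneracy s w m != 0 <->
  [/\ \det (pG s) != 0,
      forall i, det4 (pF s) (pu s i *m pG s) (pv s i *m pG s) (w i) != 0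
    & forall i j : 'I_4, (i < j)%N ->
      [/\ param_meet s i j 0 (m (i, j)) != 0, pa s i j != 0 & pb s i j != 0]].
Proof.
rewrite /nondegeneracy !mulf_eq0 !negb_or -andbA; split.
  case/and3P=> -> /prodf_neq0 hw /prodf_neq0 hm; split=> // [i|i j ltij]; first exact: hw.
  by move: (hm (i, j) isT); rewrite /= ltij !mulf_eq0 !negb_or => /and3P.
case=> -> hw hm /=; apply/andP; split; apply/prodf_neq0.
  by move=> i _; apply: hw.
move=> [i j] _ /=.
by case: ifP => [/hm[nm na nb]|_]; rewrite ?oner_eq0 // !mulf_neq0.
Qed.

Lemma tile_build (A B : point K) (l m : line K) F p a b :
  space_of A = <[F]>%VS -> space_of B = <[a *: F + b *: p]>%VS ->
  F \notin space_of l -> F \notin space_of m -> l <> m ->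
  p != 0 -> p \in space_of l -> p \in space_of m -> a != 0 -> b != 0 ->
  coherent A l B m.
Proof.
move=> EA EB Fl Fm nlm nzp pl pm nza nzb.
have out (n : line K) : F \notin space_of n -> p \in space_of n ->
    a *: F + b *: p \notin space_of n.
  move=> Fn pn; apply: contra Fn; rewrite (rpredDr _ (memvZ _ pn)) => aF.
  by rewrite -[F](scalerK nza) memvZ.
split=> //.
- move=> AB; have: p \in <[F]>%VS.
    rewrite -[p](scalerK nzb) memvZ //.
    have -> : b *: p = (a *: F + b *: p) - a *: F by rewrite addrC addKr.
    by rewrite rpredB ?memvZ ?memv_line // -EA AB EB memv_line.
  case/vlineP=> k ep; case/negP: Fl; have nzk : k != 0.
    by apply: contraNneq nzp => k0; rewrite ep k0 scale0r.
  by rewrite -[F](scalerK nzk) -ep memvZ.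
- by rewrite EA EB -!memvE; split=> //; apply: out.
- have [P EP] := point_ex nzp; exists P; rewrite EP EA EB -!memvE; split=> //.
  apply/mem_span2P; exists (- (b^-1 * a)), b^-1.
  by rewrite scalerDr !scalerA mulVf // scale1r scaleNr addKr.
Qed.

Lemma plane_ex x y z w : det4 x y z w != 0 ->
  exists h : plane K, space_of h = (<[x]> + <[y]> + <[z]>)%VS.
Proof.
move=> nz; apply: subspace_ex; rewrite dimv_disjoint_sum.
  have /dim2P -> : indep2 x y.
    move=> a b rel; have [|-> -> _ _ //] := @det4_indep _ x y z w a b 0 0 nz.
    by rewrite !scale0r !addr0.
  rewrite dim_vline; suff -> : z != 0 by [].
  by apply: contraNneq nz => ->; apply/eqP; det4_ring.
apply/eqP; rewrite -subv0; apply/subvP=> r /[!memv_cap].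
case/andP=> /mem_span2P[a [b er]] /vlineP[k ek].
have [|_ _ k0 _] := @det4_indep _ x y z w a b (- k) 0 nz.
  by rewrite -er ek; vec_ring.
by rewrite ek -[k]opprK k0 oppr0 scale0r mem0v.
Qed.


Lemma row4_flat a b c : flat (row4 a b c 0).
Proof. by rewrite /flat mxE. Qed.

(** [nondegeneracy] provides every incidence condition of [tile_build], so the
    tiles are coherent by construction. *)
Lemma param_config s (w : 'I_4 -> vec) m : param_flat s -> nondegeneracy s w m != 0 ->
  exists c, [/\ admissible c, coplanar c & hom_coords c (param_P s) (param_L s)].
Proof.
move=> fl /nondegeneracyP[nG nF np].
have injG : injective (mulmx^~ (pG s) : vec -> vec).
  have uG : pG s \in unitmx by rewrite unitmxE unitfE.
  exact: can_inj (mulmxK uG).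
have [F EF] : exists A : point K, space_of A = <[pF s]>%VS.
  apply: point_ex; apply: contraNneq (nF i0) => ->; apply/eqP; det4_ring.
have indG i : indep2 (pu s i *m pG s) (pv s i *m pG s).
  exact: det4_indep2 (nF i).
have /fin_all_exists[ln Eln] (i : 'I_4) : exists l : line K,
    space_of l = (<[pu s i *m pG s]> + <[pv s i *m pG s]>)%VS by exact: line_ex.
have nFl i : pF s \notin space_of (ln i).
  rewrite Eln; apply/negP=> /mem_span2P[a [b eF]].
  have [|/eqP] := @det4_indep _ _ _ _ _ 1 (- a) (- b) 0 (nF i).
    by rewrite {1}eF; vec_ring.
  by rewrite oner_eq0.
have nm (i j : 'I_4) : (i < j)%N -> param_meet s i j *m pG s != 0.
  case/np => nz _ _; apply: contraNneq nz => /eqP.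
  by rewrite -(mul0mx _ (pG s)) => /eqP/injG ->; rewrite mxE.
have subG u i : u \in (<[pu s i]> + <[pv s i]>)%VS -> u *m pG s \in space_of (ln i).
  rewrite Eln => /mem_span2P[a [b ->]]; apply/mem_span2P; exists a, b.
  by rewrite mulmxDl -!scalemxAl.
have Gsub u i : u *m pG s \in space_of (ln i) -> u \in (<[pu s i]> + <[pv s i]>)%VS.
  rewrite Eln => /mem_span2P[a [b e]]; apply/mem_span2P; exists a, b.
  by apply: injG; rewrite /= e mulmxDl -!scalemxAl.
have mi i j : param_meet s i j *m pG s \in space_of (ln i) by apply/subG/meet_in.
have mj i j : param_meet s i j *m pG s \in space_of (ln j).
  have [[ui vi] [uj vj]] := (fl i, fl j).
  by apply: subG; rewrite /param_meet meetC // memvN meet_in.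
have nln (i j : 'I_4) : (i < j)%N -> ln i <> ln j.
  move=> ltij eij; move/eqP: (nm _ _ ltij); apply.
  rewrite /param_meet meet_eq0 ?mul0mx //; apply: Gsub;
    by rewrite -eij subG ?mem_span2l ?mem_span2r.
have /fin_all_exists[pt Ept] (ij : 'I_4 * 'I_4) : exists A : point K, (ij.1 < ij.2)%N ->
    space_of A = <[param_pt s ij.1 ij.2]>%VS.
  case: ij => i j /=; case: ltnP => [ltij|_]; last by exists F.
  have [_ na nb] := np _ _ ltij.
  have [|A EA] := @point_ex K (param_pt s i j); last by exists A.
  apply: contraNneq (nFl i) => /eqP; rewrite addr_eq0 => /eqP eF.
  rewrite -[pF s](scalerK na) eF memvZ // memvN memvZ //.
exists (Config F (ln i0) (ln i1) (ln i2) (ln i3) (pt (i0, i1)) (pt (i0, i2))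
  (pt (i0, i3)) (pt (i1, i2)) (pt (i1, i3)) (pt (i2, i3))).
set c := Config _ _ _ _ _ _ _ _ _ _ _.
have Eline (i : 'I_4) : tnth (config_lines c) i = ln i by move: i; apply: ord4P.
have Ept' (i j : 'I_4) : (i < j)%N -> tnth (config_points c) (pair_index i j) = pt (i, j).
  by move: i j; apply: ord4P; apply: ord4P.
have EP (i j : 'I_4) : (i < j)%N -> param_P s (pair_index i j) = param_pt s i j.
  by move: i j; apply: ord4P; apply: ord4P.
split.
- apply/admissibleP => i j ltij; rewrite !Eline Ept' //.
  have [_ na nb] := np _ _ ltij.
  by apply: (tile_build EF (Ept (i, j) ltij) (nFl i) (nFl j) (nln _ _ ltij) (nm _ _ ltij)).
- have [h Eh] : exists h : plane K, space_of h =
      (<[row i0 (pG s)]> + <[row i1 (pG s)]> + <[row i2 (pG s)]>)%VS.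
    apply: (@plane_ex _ _ _ (row i3 (pG s))); rewrite det4E.
    suff -> : rows4 (row i0 (pG s)) (row i1 (pG s)) (row i2 (pG s)) (row i3 (pG s)) = pG s by [].
    by apply/matrixP; apply: ord4P => j; rewrite !mxE.
  have hu u : flat u -> u *m pG s \in space_of h.
    move=> fu; rewrite Eh mulmx_sum_row sum_ord4 fu scale0r addr0 addrA.
    by rewrite !memv_add ?memvZ ?memv_line.
  have hl i : (ln i <= h)%VS.
    have [fu fv] := fl i.
    by rewrite Eln subv_add -!memvE !hu.
  by exists h; split; apply: hl.
- split; last by move=> j; exists (pu s j *m pG s), (pv s j *m pG s); rewrite Eline.
  by apply: ord7P => [|i j ltij]; rewrite ?Ept' ?EP // (Ept (i, j) ltij).
Qed.

End Parametrization.

Section Coordinates.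
Variable K : fieldType.
Local Notation vec := 'rV[K]_4.
Local Notation idx7 k := (@Ordinal 7 k isT).
Implicit Types (u v x y z p F : vec) (h : {vspace vec}).

Lemma planeE (h : plane K) : exists x y z w,
  det4 x y z w != 0 /\ space_of h = (<[x]> + <[y]> + <[z]>)%VS.
Proof.
have [|x xh x0] := @mem_dim_lt K h 0%VS; first by rewrite dimv0 dim_subspace.
have nzx : x != 0 by rewrite memv0 in x0.
have [|y yh yx] := @mem_dim_lt K h <[x]>%VS; first by rewrite dim_subspace dim_vline nzx.
have ind := indep2_notin nzx yx.
have [|z zh zxy] := @mem_dim_lt K h (<[x]> + <[y]>)%VS.
  by move/dim2P: ind => ->; rewrite dim_subspace.
have [w nz] := det4_extend zxy ind.
exists z, x, y, w; split=> //; have [h' Eh'] := plane_ex nz; rewrite -Eh'.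
apply/eqP; rewrite eq_sym eqEdim !dim_subspace leqnn andbT Eh'.
by rewrite !subv_add -!memvE zh xh yh.
Qed.

(** Coordinates in a basis of [h] and the position of each [fij] on its line
    recover a parameter from a configuration, for any prescribed homogeneous
    coordinates. *)
Lemma config_param (c : config K) P L :
  admissible c -> coplanar c -> hom_coords c P L ->
  exists s w m, [/\ param_flat s, nondegeneracy s w m != 0, param_P s =1 P & param_L s =1 L].
Proof.
move=> /admissibleP adm [h [h1 h2 h3 h4]] [HP HL].
have hl i : (tnth (config_lines c) i <= h)%VS by move: i; apply: ord4P.
have [x [y [z [w [nz Eh]]]]] := planeE h.
pose G := rows4 x y z w.
have uG : G \in unitmx by rewrite unitmxE unitfE -det4E.
have injG : injective (mulmx^~ G : vec -> vec) by exact: can_inj (mulmxK uG).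
have flatten v : v \in space_of h -> exists u, flat u /\ v = u *m G.
  rewrite Eh => /memv_addP[_ /mem_span2P[a [b ->]] [_ /vlineP[d ->] ->]].
  exists (row4 a b d 0); rewrite row4_mulmx scale0r addr0; split=> //; exact: row4_flat.
have /fin_all_exists[uv Euv] (i : 'I_4) : exists uv : vec * vec,
    [/\ flat uv.1, flat uv.2,
      space_of (tnth (config_lines c) i) = (<[uv.1 *m G]> + <[uv.2 *m G]>)%VS
      & L i = plucker (uv.1 *m G) (uv.2 *m G)].
  have [u0 [v0 [El EL]]] := HL i.
  have [|u [fu eu]] := flatten u0; first by apply: (subvP (hl i)); rewrite El mem_span2l.
  have [|v [fv ev]] := flatten v0; first by apply: (subvP (hl i)); rewrite El mem_span2r.
  by exists (u, v); rewrite /= -eu -ev.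
have indG (i : 'I_4) : indep2 ((uv i).1 *m G) ((uv i).2 *m G).
  by apply/dim2P; have [_ _ <- _] := Euv i; apply: dim_subspace.
have ind (i : 'I_4) : indep2 (uv i).1 (uv i).2.
  move=> a b rel; apply: (indG i); rewrite !scalemxAl -mulmxDl rel mul0mx //.
have subG u (i : 'I_4) : u \in (<[(uv i).1]> + <[(uv i).2]>)%VS ->
    u *m G \in space_of (tnth (config_lines c) i).
  have [_ _ -> _] := Euv i; move=> /mem_span2P[a [b ->]]; apply/mem_span2P.
  by exists a, b; rewrite mulmxDl -!scalemxAl.
have EF : space_of (f_ c) = <[P (idx7 0)]>%VS := HP (idx7 0).
set F := P (idx7 0) in EF.
pose mt (i j : 'I_4) := meet (uv i).1 (uv i).2 (uv j).1 (uv j).2.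
have nlines (i j : 'I_4) : (i < j)%N -> tnth (config_lines c) i <> tnth (config_lines c) j.
  by move=> ltij; have [] := adm i j ltij.
have mt0 (i j : 'I_4) : (i < j)%N -> mt i j != 0.
  move=> ltij; have [[fui fvi Ei _] [fuj fvj _ _]] := (Euv i, Euv j).
  apply: meet_neq0 => // -[/subG ui /subG vi].
  apply: (nlines _ _ ltij); apply: subspace_eq.
  by rewrite Ei (lineE_in ui vi (indG i)).
have /fin_all_exists[ab Eab] (ij : 'I_4 * 'I_4) : exists ab : K * K, (ij.1 < ij.2)%N ->
    [/\ ab.1 != 0, ab.2 != 0 &
      P (pair_index ij.1 ij.2) = ab.1 *: F + ab.2 *: (mt ij.1 ij.2 *m G)].
  case: ij => i j /=; case: ltnP => [ltij|_]; last by exists (0, 0).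
  have [[fui fvi Ei _] [fuj fvj Ej _]] := (Euv i, Euv j).
  have [k [p [nk nzp eP pi pj]]] := tile_center EF (HP _) (adm i j ltij).
  have mi : mt i j *m G \in space_of (tnth (config_lines c) i) by apply/subG/meet_in.
  have mj : mt i j *m G \in space_of (tnth (config_lines c) j).
    by apply: subG; rewrite /mt meetC // memvN meet_in.
  have nzm : mt i j *m G != 0.
    by apply: contraNneq (mt0 _ _ ltij) => e; apply/eqP/injG; rewrite e mul0mx.
  have [d ep] := meet_uniq (nlines _ _ ltij) nzm mi mj pi pj.
  have nzd : d != 0 by apply: contraNneq nzp => d0; rewrite ep d0 scale0r.
  by exists (k, k * d); rewrite /= mulf_neq0 // eP ep scalerDr scalerA.
pose s := Param G (fun i => (uv i).1) (fun i => (uv i).2) F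
  (fun i j => (ab (i, j)).1) (fun i j => (ab (i, j)).2).
(* Every line occurs in one of the given tiles. *)
have nFl (i : 'I_4) : F \notin space_of (tnth (config_lines c) i).
  have nFij (j k : 'I_4) : (j < k)%N -> F \notin space_of (tnth (config_lines c) j) /\
      F \notin space_of (tnth (config_lines c) k).
    by case/adm=> _ _ [nj nk _ _] _; rewrite EF -!memvE in nj nk.
  by move: i; apply: ord4P; [case: (nFij i0 i1)|case: (nFij i0 i1)|case: (nFij i0 i2)
    |case: (nFij i0 i3)].
have /fin_all_exists[ww Eww] (i : 'I_4) : exists w',
    det4 F ((uv i).1 *m G) ((uv i).2 *m G) w' != 0.
  apply: det4_extend (indG i); have [_ _ <- _] := Euv i; exact: nFl.
have /fin_all_exists[m Em] (ij : 'I_4 * 'I_4) : exists k : 'I_4, (ij.1 < ij.2)%N ->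
    mt ij.1 ij.2 0 k != 0.
  case: ij => i j /=; case: ltnP => [/mt0/rV0Pn[k nk]|_]; last by exists i0.
  by exists k.
exists s, ww, m; split.
- by move=> i; have [] := Euv i.
- apply/nondegeneracyP; split=> [|i|i j ltij]; rewrite /= -?det4E //.
  by have [na nb _] := Eab (i, j) ltij; have := Em (i, j) ltij; split.
- apply: ord7P => [//|i j ltij]; have [_ _ ->] := Eab (i, j) ltij.
  by move: i j ltij; apply: ord4P; apply: ord4P.
- by move=> j; have [_ _ _ ->] := Euv j.
Qed.

End Coordinates.

(** * Irreducibility of the coplanar component *)

Section Path.
Variable K : fieldType.
Local Notation vec := 'rV[K]_4.
Local Notation pf := (poly_fun (fun _ : unit => @id K)).
Local Notation pmx := (@poly_mx K K unit (fun _ => id) _ _).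

Definition lerp (V : lmodType K) (x y : V) (t : K) : V := x + t *: (y - x).

Definition param_path (s0 s1 : param K) (t : K) : param K :=
  Param (lerp (pG s0) (pG s1) t)
    (fun i => lerp (pu s0 i) (pu s1 i) t) (fun i => lerp (pv s0 i) (pv s1 i) t)
    (lerp (pF s0) (pF s1) t)
    (fun i j => lerp (pa s0 i j : K^o) (pa s1 i j) t)
    (fun i j => lerp (pb s0 i j : K^o) (pb s1 i j) t).

Lemma lerp0 (V : lmodType K) (x y : V) : lerp x y 0 = x.
Proof. by rewrite /lerp scale0r addr0. Qed.

Lemma lerp1 (V : lmodType K) (x y : V) : lerp x y 1 = y.
Proof. by rewrite /lerp scale1r addrC subrK. Qed.

Lemma param_path0 s0 s1 : param_path s0 s1 0 = s0.
Proof.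
case: s0 => G u v F a b; rewrite /param_path /= !lerp0.
by congr Param; do ?[apply: funext => ?]; rewrite lerp0.
Qed.

Lemma param_path1 s0 s1 : param_path s0 s1 1 = s1.
Proof.
case: s1 => G u v F a b; rewrite /param_path /= !lerp1.
by congr Param; do ?[apply: funext => ?]; rewrite lerp1.
Qed.

Lemma poly_var : pf id.
Proof. exact: (PolyGen _ tt). Qed.

Lemma poly_mx_lerp m n (A B : 'M[K]_(m, n)) : pmx (lerp A B).
Proof.
apply: poly_mx_add; first exact: poly_mx_const.
by apply: poly_mx_scale; [exact: poly_var|exact: poly_mx_const].
Qed.

Lemma poly_fun_lerp (a b : K) : pf (lerp (a : K^o) b).
Proof. apply: PolyAdd (PolyConst _ _) (PolyMul poly_var (PolyConst _ _)). Qed.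

Section Along.
Variables s0 s1 : param K.
Let s := param_path s0 s1.

Lemma param_path_flat t : param_flat s0 -> param_flat s1 -> param_flat (s t).
Proof.
move=> fl0 fl1 i; have [[u0 v0] [u1 v1]] := (fl0 i, fl1 i).
by rewrite /flat /= /lerp !mxE u0 v0 u1 v1 subrr mulr0 addr0.
Qed.

Lemma poly_path_meet i j : pmx (fun t => param_meet (s t) i j).
Proof.
rewrite /param_meet /meet.
by repeat first [apply: poly_fun_det4|apply: poly_mx_sub|apply: poly_mx_scale
  |exact: poly_mx_lerp|exact: poly_mx_const].
Qed.

Lemma poly_path_P k : pmx (fun t => param_P (s t) k).
Proof.
have pt i j : pmx (fun t => param_pt (s t) i j).
  apply: poly_mx_add; apply: poly_mx_scale; try exact: poly_fun_lerp.
    exact: poly_mx_lerp.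
  by apply: poly_mx_mul; [exact: poly_path_meet|exact: poly_mx_lerp].
move: k; apply: ord7P; first exact: poly_mx_lerp.
by apply: ord4P; apply: ord4P => // _; apply: pt.
Qed.

Lemma poly_path_L j : pmx (fun t => param_L (s t) j).
Proof. by apply: poly_mx_plucker; apply: poly_mx_mul; apply: poly_mx_lerp. Qed.

Lemma poly_path_nondegeneracy w m : pf (fun t => nondegeneracy (s t) w m).
Proof.
apply: PolyMul; first apply: PolyMul.
- by apply: poly_fun_det; apply: poly_mx_lerp.
- apply: poly_fun_prod => i; apply: poly_fun_det4; first exact: poly_mx_lerp.
  + by apply: poly_mx_mul; apply: poly_mx_lerp.
  + by apply: poly_mx_mul; apply: poly_mx_lerp.
  + exact: poly_mx_const.
apply: poly_fun_prod => -[i j] /=; case: (i < j)%N; last exact: PolyConst.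
apply: PolyMul; first exact: poly_path_meet.
by apply: PolyMul; apply: poly_fun_lerp.
Qed.

Lemma poly_path_coord (p : {mpoly K[#|coord_index|]}) :
  pf (fun t => p.@[fun k => coord_val (param_P (s t)) (param_L (s t)) (enum_val k)]).
Proof.
apply: poly_fun_meval => k; case: (enum_val k) => [[i a]|[j [a b]]] /=.
  exact: poly_path_P.
exact: poly_path_L.
Qed.

End Along.
End Path.

Section Density.
Variable K : numFieldType.

Lemma poly_nonroot (q : {poly K}) : q != 0 -> exists t, q.[t] != 0.
Proof.
move=> nzq; pose rs := [seq n%:R : K | n <- iota 0 (size q)].
have [all_root|/allPn[t _ nt]] := boolP (all (root q) rs); last by exists t.
have /(max_poly_roots nzq all_root) : uniq rs.
  by rewrite map_inj_uniq ?iota_uniq // => m n /eqP; rewrite eqr_nat => /eqP.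
by rewrite size_map size_iota ltnn.
Qed.

(** The basic open sets of the Zariski topology on configurations. *)
Definition nonvanishing (p : {mpoly K[#|coord_index|]}) (c : config K) :=
  exists P L, hom_coords c P L /\ p.@[fun k => coord_val P L (enum_val k)] != 0.

Lemma nonvanishingP p c : ~ vanishes_at p c <-> nonvanishing p c.
Proof.
split=> [nv|[P [L [hc nz]]] v]; last by rewrite (v P L hc) eqxx in nz.
apply: contrapT => nnv; apply: nv => P L hc; apply/eqP; apply: contrapT => /negP nz.
by apply: nnv; exists P, L.
Qed.

(** Two basic open sets meeting the coplanar component have a common point on
    the affine line joining parameters of points of each: on that line, their
    equations and the nondegeneracy condition of the first endpoint are three
    nonzero polynomials. *)
Lemma coplanar_irreducible (p0 p1 : {mpoly K[#|coord_index|]}) c0 c1 :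
  admissible c0 -> coplanar c0 -> nonvanishing p0 c0 ->
  admissible c1 -> coplanar c1 -> nonvanishing p1 c1 ->
  exists c, [/\ admissible c, coplanar c, nonvanishing p0 c & nonvanishing p1 c].
Proof.
move=> adm0 cop0 [P0 [L0 [hc0 nz0]]] adm1 cop1 [P1 [L1 [hc1 nz1]]].
have [s0 [w [m [fl0 nd0 EP0 EL0]]]] := config_param adm0 cop0 hc0.
have [s1 [_ [_ [fl1 _ EP1 EL1]]]] := config_param adm1 cop1 hc1.
have [q hq] := poly_fun_horner (poly_path_nondegeneracy s0 s1 w m).
have [q0 hq0] := poly_fun_horner (poly_path_coord s0 s1 p0).
have [q1 hq1] := poly_fun_horner (poly_path_coord s0 s1 p1).
have nz (r : {poly K}) t : r.[t] != 0 -> r != 0.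
  by apply: contraNneq => ->; rewrite horner0.
have [t] : exists t, (q * q0 * q1).[t] != 0.
  apply: poly_nonroot; rewrite !mulf_neq0 //.
  - by apply: (nz _ 0); rewrite hq param_path0.
  - apply: (nz _ 0); rewrite hq0 param_path0.
    by rewrite (funext EP0) (funext EL0).
  - apply: (nz _ 1); rewrite hq1 param_path1.
    by rewrite (funext EP1) (funext EL1).
rewrite !hornerM !mulf_eq0 !negb_or -andbA hq hq0 hq1 => /and3P[nd nzp0 nzp1].
have [c [adm cop hc]] := param_config (param_path_flat t fl0 fl1) nd.
exists c; split=> //; eexists; eexists; split; eassumption.
Qed.

End Density.

(** * A configuration in the generic locus *)

Section Example.
Variable K : fieldType.
Local Notation vec := 'rV[K]_4.
Local Notation idx7 k := (@Ordinal 7 k isT).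

(** In the flat plane with coordinates [x], [y], [z], the lines are [x = 0],
    [y = 0], [z = 0] and [x + y + z = 0]; the point [f] is the pole, and [fij] is
    the pole plus the intersection of [fi] and [fj]. *)
Definition example : param K :=
  Param 1%:M
    (nth 0 [:: row4 0 1 0 0; row4 1 0 0 0; row4 1 0 0 0; row4 1 0 (-1) 0])
    (nth 0 [:: row4 0 0 1 0; row4 0 0 1 0; row4 0 1 0 0; row4 0 1 (-1) 0])
    (row4 0 0 0 1) (fun _ _ => 1) (fun _ _ => 1).

Ltac row4_ring := rewrite /det4 /plucker_pairing ?pluckerE !mxE /=; ring.

Lemma meet_row4 (a b c a' b' c' x y z x' y' z' : K) :
  meet (row4 a b c 0) (row4 a' b' c' 0) (row4 x y z 0) (row4 x' y' z' 0) =
  let d k l m := k * (y * z' - z * y') - l * (x * z' - z * x') + m * (x * y' - y * x') in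
  row4 (d a b c * a' - d a' b' c' * a) (d a b c * b' - d a' b' c' * b)
     (d a b c * c' - d a' b' c' * c) 0.
Proof. by apply/rowP; apply: ord4P; rewrite /meet; row4_ring. Qed.

Lemma det4_row4 a0 a1 a2 a3 b0 b1 b2 b3 c0 c1 c2 c3 d0 d1 d2 d3 :
  det4 (row4 a0 a1 a2 a3) (row4 b0 b1 b2 b3) (row4 c0 c1 c2 c3) (row4 d0 d1 d2 d3) =
  (a0 * b1 - b0 * a1) * (c2 * d3 - c3 * d2) - (a0 * b2 - b0 * a2) * (c1 * d3 - c3 * d1)
  + (a0 * b3 - b0 * a3) * (c1 * d2 - c2 * d1) + (a1 * b2 - b1 * a2) * (c0 * d3 - c3 * d0)
  - (a1 * b3 - b1 * a3) * (c0 * d2 - c2 * d0)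
  + (a2 * b3 - b2 * a3) * (c0 * d1 - c1 * d0) :> K.
Proof. by rewrite /det4 /plucker_pairing !pluckerE !mxE. Qed.

Lemma param_pt_example (i j : 'I_4) x y z x' y' z' :
  param_meet example i j = row4 x y z 0 -> x' = x -> y' = y -> z' = z ->
  param_pt example i j = row4 x' y' z' 1.
Proof.
move=> e -> -> ->; rewrite /param_pt e /= mulmx1 !scale1r.
by apply/rowP; apply: ord4P; rewrite !mxE /=; ring.
Qed.

Lemma genericity_example : genericity (param_P example) (param_L example) = -1.
Proof.
have E01 : param_P example (idx7 1) = row4 0 0 (-1) 1.
  by apply: (@param_pt_example i0 i1); [exact: meet_row4|..]; rewrite /=; ring.
have E02 : param_P example (idx7 2) = row4 0 (-1) 0 1.
  by apply: (@param_pt_example i0 i2); [exact: meet_row4|..]; rewrite /=; ring.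
have E03 : param_P example (idx7 3) = row4 0 (-1) 1 1.
  by apply: (@param_pt_example i0 i3); [exact: meet_row4|..]; rewrite /=; ring.
have E12 : param_P example (idx7 4) = row4 (-1) 0 0 1.
  by apply: (@param_pt_example i1 i2); [exact: meet_row4|..]; rewrite /=; ring.
have E13 : param_P example (idx7 5) = row4 (-1) 0 1 1.
  by apply: (@param_pt_example i1 i3); [exact: meet_row4|..]; rewrite /=; ring.
have E23 : param_P example (idx7 6) = row4 (-1) 1 0 1.
  by apply: (@param_pt_example i2 i3); [exact: meet_row4|..]; rewrite /=; ring.
rewrite /genericity E01 E02 E03 E12 E13 E23 /param_L /= !mulmx1 /genericity_of.
have -> : row i2 (plucker (row4 1 0 0 0) (row4 0 0 1 0)) = row4 (-1) 0 0 0 :> vec.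
  by apply/rowP; apply: ord4P; rewrite mxE pluckerE !mxE /=; ring.
have -> : cox_point (row4 0 0 (-1) 1) (row4 0 (-1) 0 1) (row4 0 (-1) 1 1) (row4 (-1) 0 0 1)
    (row4 (-1) 0 1 1) (row4 (-1) 1 0 1) = row4 1 (-1) 1 (-1) :> vec.
  have Ez : det4 (row4 0 0 (-1) 1) (row4 0 (-1) 1 1) (row4 (-1) 0 1 1) (row4 (-1) 0 0 1) *:
      row4 0 (-1) 0 1 -
    det4 (row4 0 0 (-1) 1) (row4 0 (-1) 1 1) (row4 (-1) 0 1 1) (row4 0 (-1) 0 1) *:
      row4 (-1) 0 0 1 = row4 (-1) 1 0 0 :> vec.
    by apply/rowP; apply: ord4P; rewrite !det4_row4 !mxE /=; ring.
  by rewrite /cox_point Ez; apply/rowP; apply: ord4P; rewrite !det4_row4 !mxE /=; ring.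
rewrite -[plucker_pairing _ _ _]/(det4 _ _ _ _) -[param_P _ _]/(row4 0 0 0 1) !det4_row4.
ring.
Qed.

Lemma nondegeneracy_example : exists w m, nondegeneracy example w m != 0.
Proof.
exists (nth 0 [:: row4 1 0 0 0; row4 0 1 0 0; row4 0 0 1 0; row4 0 0 1 0]).
exists (fun ij : 'I_4 * 'I_4 =>
  if ij.1 == i0 then if ij.2 == i1 then i2 else i1 else i0).
have pos (a : K) : a = 1 -> a != 0 by move=> ->; apply: oner_neq0.
have neg (a : K) : a = -1 -> a != 0 by move=> ->; rewrite oppr_eq0 oner_neq0.
apply/nondegeneracyP; split.
- by rewrite det1 oner_eq0.
- by apply: ord4P; rewrite /= !mulmx1 det4_row4;
    first [apply: pos; ring|apply: neg; ring].
- apply: ord4P; apply: ord4P => // _; split; rewrite ?oner_eq0 //=;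
    rewrite /param_meet /= meet_row4 mxE /=; first [apply: pos; ring|apply: neg; ring].
Qed.

End Example.

(** * Existence and uniqueness of the last vertex *)

Section Final.
Variable K : numFieldType.

Lemma generically_completable : generically (@cube_completable K).
Proof.
have [p hp] := genericity_mpoly K.
have [w [m nd]] := nondegeneracy_example K.
have flat_ex : param_flat (example K).
  by apply: ord4P; rewrite /flat /= !mxE.
have [c1 [adm1 cop1 hc1]] := param_config flat_ex nd.
have U1 : nonvanishing p c1.
  exists (param_P (example K)), (param_L (example K)).
  by rewrite hp genericity_example oppr_eq0 oner_eq0.
exists (nonvanishing p); split.
- exists (fun q => q = p) => c; split=> [nU q ->|v /nonvanishingP]; last by apply; apply: v.
  by apply: contrapT => /nonvanishingP.
- by exists c1.
- move=> V [S hS] [c0 [[adm0 cop0] V0]].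
  have [q Sq [P [L [hc nz]]]] : exists2 q, S q & nonvanishing q c0.
    apply: contrapT => nq; suff : ~ V c0 by [].
    apply/hS => q Sq; apply: contrapT => /nonvanishingP nv; apply: nq.
    by exists q.
  have U0 : nonvanishing q c0 by exists P, L.
  have [c [adm cop Uq Up]] := coplanar_irreducible adm0 cop0 U0 adm1 cop1 U1.
  exists c; split=> //; apply: contrapT => nV.
  by move/nonvanishingP: Uq; apply; apply: (proj1 (hS c)).
- by move=> c adm [P [L [hc nz]]]; apply: genericity_completable adm hc _; rewrite -hp.
Qed.

End Final.

Theorem theorem9p6 (R : realType) (K : fieldType)
    (hK : K = (R : fieldType) \/ K = (R[i] : fieldType)) :
  generically (fun c : config K =>
    [/\ exists! l, completes3 (f1 c) (f2 c) (f3 c) (f12 c) (f13 c) (f23 c) l,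
        exists! l, completes3 (f1 c) (f2 c) (f4 c) (f12 c) (f14 c) (f24 c) l,
        exists! l, completes3 (f1 c) (f3 c) (f4 c) (f13 c) (f14 c) (f34 c) l
      & exists! l, completes3 (f2 c) (f3 c) (f4 c) (f23 c) (f24 c) (f34 c) l] /\
    forall f123 f124 f134 f234 : line K,
      completes3 (f1 c) (f2 c) (f3 c) (f12 c) (f13 c) (f23 c) f123 ->
      completes3 (f1 c) (f2 c) (f4 c) (f12 c) (f14 c) (f24 c) f124 ->
      completes3 (f1 c) (f3 c) (f4 c) (f13 c) (f14 c) (f34 c) f134 ->
      completes3 (f2 c) (f3 c) (f4 c) (f23 c) (f24 c) (f34 c) f234 ->
      exists! f1234 : point K, completes4 c f123 f124 f134 f234 f1234).
Proof.
by case: hK => ->; [exact: (generically_completable R)|exact: (generically_completable R[i])].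
Qed.
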